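(* Let $k$ be an algebraically closed field and let $\mathcal T$ be an indecomposable $k$-linear Hom-finite Krull-Schmidt triangulated category with Serre functor. Assume that $\mathcal T$ is homotopy-like. Then: (1) Any exceptional $1$-cycle in $\mathcal T$ is indecomposable, and at the mouth. (2) Any object in an exceptional $n$-cycle in $\mathcal T$ with $n\ge 3$ is at the mouth.
   Context: The shift functor is $[1]$. The (right) Serre functor $S:\mathcal T\to\mathcal T$ is a triangle equivalence with $k$-linear isomorphisms $\operatorname{Hom}_{\mathcal T}(X,Y)\cong \operatorname{Hom}_{\mathcal T}(Y,S(X))^*$, functorial in $X$ and $Y$, where $(-)^*=\operatorname{Hom}_k(-,k)$. A triangulated category is indecomposable if it is not equivalent to a product of two nonzero triangulated categories. $\mathcal T$ is homotopy-like if $M\ncong M[i]$ for every indecomposable object $M$ and every integer $i\neq 0$. Auslander-Reiten triangles: a distinguished triangle $X\to Y\to Z\xrightarrow{h}X[1]$ is an Auslander-Reiten triangle if $X,Z$ are indecomposable, $h\ne 0$, and every morphism $W\to Z$ that is not a split epimorphism factors through $Y\to Z$. Since $\mathcal T$ has a Serre functor, for every indecomposable $E$ there is an Auslander-Reiten triangle $\tau E\to Z\to E\to S(E)$ with $\tau E=S(E)[-1]$. An indecomposable object is at the mouth if the middle term of the Auslander-Reiten triangle ending at it is indecomposable (in particular nonzero); equivalently, the middle term of the Auslander-Reiten triangle starting from it is indecomposable. For objects $X,Y$, put $\operatorname{Hom}^\bullet(X,Y)=\bigoplus_i \operatorname{Hom}_{\mathcal T}(X,Y[i])[-i]$, a complex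 of $k$-vector spaces with zero differentials (so $k[-d]$ is $k$ placed in degree $d$). An exceptional $1$-cycle is an object $E$ such that, for some integer $d$, $S(E)\cong E[d]$ (i.e. $E$ is $d$-Calabi-Yau) and $\operatorname{Hom}^\bullet(E,E)\cong k\oplus k[-d]$. An exceptional $n$-cycle with $n\ge 2$ is a sequence $(E_1,\dots,E_n)$ of objects such that: (E1) $\operatorname{Hom}^\bullet(E_i,E_i)\cong k$ for each $i$; (E2) there are integers $m_i$ with $S(E_i)\cong E_{i+1}[m_i]$ for each $i$, where $E_{n+1}:=E_1$; (E3) $\operatorname{Hom}^\bullet(E_i,E_j)=0$ unless $j=i$ or $j=i+1$ (indices modulo $n$; the condition is vacuous if $n=2$). *)

(* Defs.v *)
From mathcomp Require Import all_boot all_order all_algebra.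

Set Implicit Arguments.
Unset Strict Implicit.
Unset Printing Implicit Defensive.

Import GRing.Theory.
Local Open Scope ring_scope.

Record linCat (k : fieldType) := LinCat {
  obj :> Type;
  hom : obj -> obj -> lmodType k;
  idm : forall X, hom X X;
  comp : forall X Y Z, hom Y Z -> hom X Y -> hom X Z;
  comp_assoc : forall W X Y Z (h : hom Y Z) (g : hom X Y) (f : hom W X),
    comp h (comp g f) = comp (comp h g) f;
  comp_idl : forall X Y (f : hom X Y), comp (idm Y) f = f;
  comp_idr : forall X Y (f : hom X Y), comp f (idm X) = f;
  comp_linl : forall X Y Z (f : hom X Y), linear (fun g : hom Y Z => comp g f);
  comp_linr : forall X Y Z (g : hom Y Z), linear (fun f : hom X Y => comp g f)
}.

Arguments hom {k l} _ _ : rename.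
Arguments idm {k l} _ : rename.
Arguments comp {k l X Y Z} _ _ : rename.

Declare Scope cat_scope.
Delimit Scope cat_scope with cat.
Local Open Scope cat_scope.
Notation "g ∘ f" := (comp g f) (at level 40, left associativity) : cat_scope.

Record functor (k : fieldType) (C D : linCat k) := Functor {
  fobj :> C -> D;
  fmap : forall X Y, hom X Y -> hom (fobj X) (fobj Y);
  fmap_id : forall X, fmap (idm X) = idm (fobj X);
  fmap_comp : forall X Y Z (g : hom Y Z) (f : hom X Y),
    fmap (g ∘ f) = fmap g ∘ fmap f;
  fmap_lin : forall X Y, linear (@fmap X Y)
}.

Arguments fmap {k C D} _ {X Y} _.

Definition functor_id (k : fieldType) (C : linCat k) : functor C C.
Proof. by refine (@Functor k C C (fun X => X) (fun X Y f => f) _ _ _). Defined.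

Definition functor_comp (k : fieldType) (B C D : linCat k)
  (G : functor C D) (F : functor B C) : functor B D.
Proof.
refine (@Functor k B D (fun X => G (F X)) (fun X Y f => fmap G (fmap F f)) _ _ _).
- by move=> X; rewrite !fmap_id.
- by move=> X Y Z g f; rewrite !fmap_comp.
- by move=> X Y a f g; rewrite !fmap_lin.
Defined.

Record natIso (k : fieldType) (C D : linCat k) (F G : functor C D) := NatIso {
  nat_fwd : forall X, hom (F X) (G X);
  nat_bwd : forall X, hom (G X) (F X);
  nat_fwdK : forall X, nat_bwd X ∘ nat_fwd X = idm (F X);
  nat_bwdK : forall X, nat_fwd X ∘ nat_bwd X = idm (G X);
  nat_natural : forall X Y (f : hom X Y),
    nat_fwd Y ∘ fmap F f = fmap G f ∘ nat_fwd X
}.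

Arguments nat_fwd {k C D F G} _ X.
Arguments nat_bwd {k C D F G} _ X.

Definition is_equivalence (k : fieldType) (C D : linCat k) (F : functor C D) : Prop :=
  exists G : functor D C,
    inhabited (natIso (functor_comp G F) (functor_id C)) /\
    inhabited (natIso (functor_comp F G) (functor_id D)).

Section Objects.
Variables (k : fieldType) (C : linCat k).
Implicit Types X Y Z A B : C.

Definition is_iso X Y (f : hom X Y) : Prop :=
  exists g : hom Y X, g ∘ f = idm X /\ f ∘ g = idm Y.

Definition isomorphic X Y : Prop := exists f : hom X Y, is_iso f.

Definition split_epi X Y (f : hom X Y) : Prop :=
  exists s : hom Y X, f ∘ s = idm Y.

Definition is_zero X : Prop :=
  forall Y, (forall f : hom X Y, f = 0) /\ (forall f : hom Y X, f = 0).

Definition is_direct_sum X A B : Prop :=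
  exists (iA : hom A X) (iB : hom B X) (pA : hom X A) (pB : hom X B),
    [/\ pA ∘ iA = idm A, pB ∘ iB = idm B, pB ∘ iA = 0, pA ∘ iB = 0
      & iA ∘ pA + iB ∘ pB = idm X].

Definition is_finite_direct_sum X n (A : 'I_n -> C) : Prop :=
  exists (i_ : forall j, hom (A j) X) (p_ : forall j, hom X (A j)),
    [/\ forall j, p_ j ∘ i_ j = idm (A j),
        forall j l, j != l -> p_ l ∘ i_ j = 0
      & \sum_j i_ j ∘ p_ j = idm X].

Definition indecomposable X : Prop :=
  ~ is_zero X /\ forall A B, is_direct_sum X A B -> is_zero A \/ is_zero B.

Definition local_end X : Prop :=
  idm X <> 0 /\
  forall f g : hom X X, is_iso (f + g) -> is_iso f \/ is_iso g.

Definition krull_schmidt : Prop :=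
  forall X, exists (n : nat) (A : 'I_n -> C),
    is_finite_direct_sum X A /\ forall j, local_end (A j).

Definition nonzero_cat : Prop := exists X, ~ is_zero X.

End Objects.

Definition lin_iso (k : fieldType) (U V : lmodType k) : Prop :=
  exists f : {linear U -> V}, bijective f.

Definition hom_finite (k : fieldType) (C : linCat k) : Prop :=
  forall X Y : C, exists n : nat, lin_iso (hom X Y) 'rV[k]_n.

(** The shift is an auto-equivalence with a chosen quasi-inverse, so that no
    equalities between objects are needed.  [dist f g h] says that
    X --f--> Y --g--> Z --h--> X[1] is a distinguished triangle. *)
Record triCat (k : fieldType) := TriCat {
  tcat :> linCat k;
  shift : functor tcat tcat;
  unshift : functor tcat tcat;
  shiftK : natIso (functor_comp unshift shift) (functor_id tcat);
  unshiftK : natIso (functor_comp shift unshift) (functor_id tcat);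
  dist : forall X Y Z : tcat, hom X Y -> hom Y Z -> hom Z (shift X) -> Prop;

  has_zero : exists Z : tcat, is_zero Z;
  has_direct_sums : forall A B : tcat, exists X, is_direct_sum X A B;

  dist_iso : forall (X Y Z X' Y' Z' : tcat)
    (f : hom X Y) (g : hom Y Z) (h : hom Z (shift X))
    (f' : hom X' Y') (g' : hom Y' Z') (h' : hom Z' (shift X'))
    (a : hom X X') (b : hom Y Y') (c : hom Z Z'),
    is_iso a -> is_iso b -> is_iso c ->
    b ∘ f = f' ∘ a -> c ∘ g = g' ∘ b -> fmap shift a ∘ h = h' ∘ c ->
    dist f g h -> dist f' g' h';
  dist_id : forall X Z : tcat, is_zero Z ->
    dist (idm X) (0 : hom X Z) (0 : hom Z (shift X));
  dist_cone : forall (X Y : tcat) (f : hom X Y),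
    exists (Z : tcat) (g : hom Y Z) (h : hom Z (shift X)), dist f g h;

  dist_rot : forall (X Y Z : tcat)
    (f : hom X Y) (g : hom Y Z) (h : hom Z (shift X)),
    dist f g h <-> dist g h (- fmap shift f);

  dist_mor : forall (X Y Z X' Y' Z' : tcat)
    (f : hom X Y) (g : hom Y Z) (h : hom Z (shift X))
    (f' : hom X' Y') (g' : hom Y' Z') (h' : hom Z' (shift X'))
    (a : hom X X') (b : hom Y Y'),
    dist f g h -> dist f' g' h' -> b ∘ f = f' ∘ a ->
    exists c : hom Z Z', c ∘ g = g' ∘ b /\ fmap shift a ∘ h = h' ∘ c;

  dist_oct : forall (X Y Z X' Y' Z' : tcat)
    (f : hom X Y) (a : hom Y Z') (a' : hom Z' (shift X))
    (g : hom Y Z) (b : hom Z X') (b' : hom X' (shift Y))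
    (c : hom Z Y') (c' : hom Y' (shift X)),
    dist f a a' -> dist g b b' -> dist (g ∘ f) c c' ->
    exists (u : hom Z' Y') (v : hom Y' X'),
      [/\ dist u v (fmap shift a ∘ b'),
          u ∘ a = c ∘ g, c' ∘ u = a', v ∘ c = b & b' ∘ v = fmap shift f ∘ c']
}.

Arguments shift {k} _.
Arguments unshift {k} _.
Arguments shiftK {k} _.
Arguments unshiftK {k} _.
Arguments dist {k t X Y Z} _ _ _ : rename.

Record triFunctor (k : fieldType) (C D : triCat k) := TriFunctor {
  tfun :> functor C D;
  tfun_shift : natIso (functor_comp tfun (shift C)) (functor_comp (shift D) tfun);
  tfun_dist : forall (X Y Z : C)
    (f : hom X Y) (g : hom Y Z) (h : hom Z (shift C X)),
    dist f g h ->
    dist (fmap tfun f) (fmap tfun g) (nat_fwd tfun_shift X ∘ fmap tfun h)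
}.

Definition tri_equivalent (k : fieldType) (C D : triCat k) : Prop :=
  exists F : triFunctor C D, is_equivalence F.

Definition prod_cat (k : fieldType) (A B : linCat k) : linCat k.
Proof.
refine (@LinCat k (A * B)%type (fun X Y => (hom X.1 Y.1 * hom X.2 Y.2)%type)
  (fun X => (idm X.1, idm X.2)) (fun X Y Z g f => (g.1 ∘ f.1, g.2 ∘ f.2))
  _ _ _ _ _).
- by move=> W X Y Z h g f; rewrite /= !comp_assoc.
- by move=> X Y [f1 f2]; rewrite /= !comp_idl.
- by move=> X Y [f1 f2]; rewrite /= !comp_idr.
- by move=> X Y Z f a g h; congr pair; rewrite /= comp_linl.
- by move=> X Y Z f a g h; congr pair; rewrite /= comp_linr.
Defined.

Definition prod_functor (k : fieldType) (A B A' B' : linCat k)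
  (F : functor A A') (G : functor B B') : functor (prod_cat A B) (prod_cat A' B').
Proof.
refine (@Functor k (prod_cat A B) (prod_cat A' B') (fun X => (F X.1, G X.2))
  (fun X Y f => (fmap F f.1, fmap G f.2)) _ _ _).
- by move=> X; rewrite /= !fmap_id.
- by move=> X Y Z g f; rewrite /= !fmap_comp.
- by move=> X Y a f g; congr pair; rewrite /= fmap_lin.
Defined.

Section ProductLemmas.
Variables (k : fieldType) (A B : linCat k).

Lemma prod_is_zero (X : prod_cat A B) : is_zero X.1 -> is_zero X.2 -> is_zero X.
Proof.
move=> z1 z2 Y; have [i1 t1] := z1 Y.1; have [i2 t2] := z2 Y.2.
split=> [[f1 f2]|[f1 f2]]; first by rewrite (i1 f1) (i2 f2).
by rewrite (t1 f1) (t2 f2).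
Qed.

Lemma is_zero_prod (X : prod_cat A B) : is_zero X -> is_zero X.1 /\ is_zero X.2.
Proof.
move=> zX; split=> Y; split=> f.
- by have [z _] := zX (Y, X.2); case: (z (f, 0)).
- by have [_ z] := zX (Y, X.2); case: (z (f, 0)).
- by have [z _] := zX (X.1, Y); case: (z (0, f)).
- by have [_ z] := zX (X.1, Y); case: (z (0, f)).
Qed.

Lemma is_iso_prod (X Y : prod_cat A B) (f : hom X Y) :
  is_iso f -> is_iso (f.1 : hom X.1 Y.1) /\ is_iso (f.2 : hom X.2 Y.2).
Proof.
by case=> g [[e1 e2] [e3 e4]]; split; [exists g.1 | exists g.2].
Qed.

End ProductLemmas.

Definition prod_cancel (k : fieldType) (A B A' B' : linCat k)
    (F : functor A A') (F' : functor A' A) (G : functor B B') (G' : functor B' B)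
    (p : natIso (functor_comp F' F) (functor_id A))
    (q : natIso (functor_comp G' G) (functor_id B)) :
  natIso (functor_comp (prod_functor F' G') (prod_functor F G))
         (functor_id (prod_cat A B)).
Proof.
refine (@NatIso k (prod_cat A B) (prod_cat A B)
  (functor_comp (prod_functor F' G') (prod_functor F G))
  (functor_id (prod_cat A B))
  (fun X => (nat_fwd p X.1, nat_fwd q X.2))
  (fun X => (nat_bwd p X.1, nat_bwd q X.2)) _ _ _) => [X|X|X Y f].
- by congr pair; [exact: (nat_fwdK p) | exact: (nat_fwdK q)].
- by congr pair; [exact: (nat_bwdK p) | exact: (nat_bwdK q)].
- by congr pair; [exact: (nat_natural p) | exact: (nat_natural q)].
Defined.

Definition prod_dist (k : fieldType) (A B : triCat k) (X Y Z : prod_cat A B)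
    (f : hom X Y) (g : hom Y Z)
    (h : hom Z (prod_functor (shift A) (shift B) X)) : Prop :=
  dist (f.1 : hom X.1 Y.1) (g.1 : hom Y.1 Z.1) h.1 /\
  dist (f.2 : hom X.2 Y.2) (g.2 : hom Y.2 Z.2) h.2.

Definition prod_tri (k : fieldType) (A B : triCat k) : triCat k.
Proof.
refine (@TriCat k (prod_cat A B) (prod_functor (shift A) (shift B))
  (prod_functor (unshift A) (unshift B)) _ _ (@prod_dist k A B)
  _ _ _ _ _ _ _ _).
- exact: prod_cancel (shiftK A) (shiftK B).
- exact: prod_cancel (unshiftK A) (unshiftK B).
- have [ZA zA] := has_zero A; have [ZB zB] := has_zero B.
  by exists (ZA, ZB); apply: prod_is_zero.
- move=> [U1 U2] [V1 V2].
  have [W1 [iA [iB [pA [pB [e1 e2 e3 e4 e5]]]]]] := has_direct_sums U1 V1.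
  have [W2 [jA [jB [qA [qB [d1 d2 d3 d4 d5]]]]]] := has_direct_sums U2 V2.
  exists (W1, W2), (iA, jA), (iB, jB), (pA, qA), (pB, qB).
  by split; apply/pair_equal_spec.
- move=> X Y Z X' Y' Z' f g h f' g' h' a b c.
  move=> /is_iso_prod[a1 a2] /is_iso_prod[b1 b2] /is_iso_prod[c1 c2].
  move=> [e1 e2] [e3 e4] [e5 e6] [D1 D2].
  by split; [apply: (dist_iso a1 b1 c1) D1 | apply: (dist_iso a2 b2 c2) D2].
- by move=> X Z /is_zero_prod[z1 z2]; split; apply: dist_id.
- move=> X Y f.
  have [Z1 [g1 [h1 D1]]] := dist_cone (f.1 : hom X.1 Y.1).
  have [Z2 [g2 [h2 D2]]] := dist_cone (f.2 : hom X.2 Y.2).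
  by exists (Z1, Z2), (g1, g2), (h1, h2).
- move=> X Y Z f g h; split=> -[D1 D2].
  + by split; [apply: (proj1 (dist_rot _ _ _)) | apply: (proj1 (dist_rot _ _ _))].
  + by split; [apply: (proj2 (dist_rot _ _ _)) | apply: (proj2 (dist_rot _ _ _))].
- move=> X Y Z X' Y' Z' f g h f' g' h' a b [D1 D2] [D1' D2'] [e1 e2].
  have [c1 [p1 q1]] := dist_mor D1 D1' e1.
  have [c2 [p2 q2]] := dist_mor D2 D2' e2.
  by exists (c1, c2); split; congr pair.
- move=> X Y Z X' Y' Z' f a a' g b b' c c' [D1 D2] [E1 E2] [F1 F2].
  have [u1 [v1 [G1 p1 q1 r1 s1]]] := dist_oct D1 E1 F1.
  have [u2 [v2 [G2 p2 q2 r2 s2]]] := dist_oct D2 E2 F2.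
  exists (u1, u2), (v1, v2).
  split; [by [] | by congr pair | | | by congr pair].
    by rewrite [RHS]surjective_pairing -q1 -q2.
  by rewrite [RHS]surjective_pairing -r1 -r2.
Defined.

Definition indecomposable_cat (k : fieldType) (T : triCat k) : Prop :=
  ~ exists A B : triCat k,
      [/\ nonzero_cat A, nonzero_cat B & tri_equivalent (prod_tri A B) T].

(** The functionals {linear V -> k^o} carry no k-module structure in the
    library, so linearity and bijectivity of Hom(X, Y) -> Hom(Y, S X)^* are
    stated pointwise. *)
Record serreFunctor (k : fieldType) (T : triCat k) := SerreFunctor {
  serre :> triFunctor T T;
  serre_equiv : is_equivalence serre;
  serre_phi : forall X Y : T, hom X Y -> {linear hom Y (serre X) -> k^o};
  serre_lin : forall (X Y : T) (a : k) (f g : hom X Y) (u : hom Y (serre X)),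
    serre_phi (a *: f + g) u = a *: serre_phi f u + serre_phi g u;
  serre_bij : forall (X Y : T) (l : {linear hom Y (serre X) -> k^o}),
    exists! f : hom X Y, serre_phi f =1 l;
  serre_natl : forall (X' X Y : T) (v : hom X' X) (f : hom X Y)
      (u : hom Y (serre X')),
    serre_phi (f ∘ v) u = serre_phi f (fmap serre v ∘ u);
  serre_natr : forall (X Y Y' : T) (w : hom Y Y') (f : hom X Y)
      (u : hom Y' (serre X)),
    serre_phi (w ∘ f) u = serre_phi f (u ∘ w)
}.

Section Cycles.
Variables (k : fieldType) (T : triCat k).

Definition shiftz (X : T) (i : int) : T :=
  match i with
  | Posz n => iter n (shift T) X
  | Negz n => iter n.+1 (unshift T) X
  end.

Definition homotopy_like : Prop :=
  forall M : T, indecomposable M ->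
  forall i : int, i != 0 -> ~ isomorphic M (shiftz M i).

Definition AR_triangle (X Y Z : T)
    (f : hom X Y) (g : hom Y Z) (h : hom Z (shift T X)) : Prop :=
  [/\ dist f g h, indecomposable X, indecomposable Z, h <> 0
    & forall (W : T) (t : hom W Z), ~ split_epi t ->
        exists s : hom W Y, t = g ∘ s].

(** The Auslander-Reiten triangle ending at E is unique up to isomorphism,
    hence so is its middle term. *)
Definition at_mouth (E : T) : Prop :=
  indecomposable E /\
  exists (X Y : T) (f : hom X Y) (g : hom Y E) (h : hom E (shift T X)),
    AR_triangle f g h /\ indecomposable Y.

(** A complex with zero differentials is its family of components; [hom_gr X Y]
    in degree i is Hom(X, Y[i]), and [kgr d] is k placed in degree d, that is
    k[-d]. *)
Definition gr := int -> lmodType k.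
Definition hom_gr (X Y : T) : gr := fun i => hom X (shiftz Y i).
Definition kgr (d : int) : gr := fun i => 'rV[k]_(i == d).
Definition gr0 : gr := fun=> 'rV[k]_0.
Definition gr_sum (U V : gr) : gr := fun i => (U i * V i)%type.
Definition gr_iso (U V : gr) : Prop := forall i, lin_iso (U i) (V i).

Variable S : serreFunctor T.

Definition exceptional_1cycle (E : T) : Prop :=
  exists d : int,
    isomorphic (S E) (shiftz E d) /\
    gr_iso (hom_gr E E) (gr_sum (kgr 0) (kgr d)).

Definition exceptional_cycle (n : nat) (E : 'I_n -> T) : Prop :=
  [/\ (2 <= n)%N,
      forall i, gr_iso (hom_gr (E i) (E i)) (kgr 0),
      exists m : 'I_n -> int,
        forall i, isomorphic (S (E i)) (shiftz (E (ordS i)) (m i))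
    & forall i j, j != i -> j != ordS i -> gr_iso (hom_gr (E i) (E j)) gr0].

End Cycles.

(* Main.v *)
From HB Require Import structures.
From mathcomp Require Import all_boot all_order all_algebra.
From mathcomp Require Import zify ring.
From Stdlib Require Import Classical ClassicalEpsilon.
Require Import Defs.

(** Let τE -> Y -> E -> SE be an Auslander-Reiten triangle, with f : τE -> Y and
    h : E -> SE. If Hom(τE, Y) is spanned by f and h is not invertible, then Y is
    indecomposable ([middle_indecomposable]): for a decomposition of Y into two
    nonzero objects both components of f would be nonzero, as otherwise a summand
    of Y would be a summand of E and give a section of Y -> E; so they would be
    linearly independent in Hom(τE, Y). By the long exact sequence Hom(τE, Y) is
    a line as soon as h is injective on Hom(τE, E) and the radical of End(τE)
    dies in Y ([at_mouth_criterion]). The triangle itself comes from Serre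
    duality: h represents a linear form on End(E) that kills the radical but not
    the identity ([almost_vanishing_map]). All this is carried out when End(E) is
    k or the ring of dual numbers k[x]/(x^2).

    In an n-cycle with n >= 3, up to shift τE_i is E_(i+1), which has no nonzero
    maps to shifts of E_i, and End(E_i) = k. For a 1-cycle with d nonzero,
    τE = E[d - 1] and End(E) = k; maps E[d - 1] -> E exist only for d = 1, where
    they are multiples of an isomorphism and are not killed by h. Homotopy-likeness
    excludes that h is invertible.

    The case d = 0 needs the indecomposability of T. There End(E) is a
    two-dimensional algebra, and if E has a local endomorphism ring it is the
    ring of dual numbers since k is algebraically closed ([local_plane_dual]).
    Otherwise E has two orthogonal summands A and B with End(A) = k, SA = A, and
    no maps between the shifts of A and B. Every indecomposable object is then a
    shift of A or orthogonal to all of them ([local_hom_spherical0]), so T is a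
    product of two triangulated categories, one containing A and the other
    containing B ([spherical0_generates]). That the sum functor from this product
    is a triangle equivalence ([orthogonal_decomposition]) rests on the fact that
    a direct sum of distinguished triangles is distinguished ([dist_dsum]). *)

Set Implicit Arguments.
Unset Strict Implicit.
Unset Printing Implicit Defensive.

Import GRing.Theory.
Local Open Scope ring_scope.
Local Open Scope cat_scope.

(** * Linear categories, local and dual-number endomorphism rings *)

Section LinearCategory.
Variables (k : fieldType) (C : linCat k).
Implicit Types X Y Z A B W : C.

Lemma compDl X Y Z (g g' : hom Y Z) (f : hom X Y) :
  (g + g') ∘ f = g ∘ f + g' ∘ f.
Proof. by have := comp_linl f 1 g g'; rewrite !scale1r. Qed.

Lemma compDr X Y Z (g : hom Y Z) (f f' : hom X Y) :
  g ∘ (f + f') = g ∘ f + g ∘ f'.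
Proof. by have := comp_linr g 1 f f'; rewrite !scale1r. Qed.

Lemma comp0l X Y Z (f : hom X Y) : (0 : hom Y Z) ∘ f = 0.
Proof. by apply: (addIr (0 ∘ f)); rewrite -compDl !add0r. Qed.

Lemma comp0r X Y Z (g : hom Y Z) : g ∘ (0 : hom X Y) = 0.
Proof. by apply: (addIr (g ∘ 0)); rewrite -compDr !add0r. Qed.

Lemma compZl X Y Z a (g : hom Y Z) (f : hom X Y) : (a *: g) ∘ f = a *: (g ∘ f).
Proof. by have := comp_linl f a g 0; rewrite comp0l !addr0. Qed.

Lemma compZr X Y Z a (g : hom Y Z) (f : hom X Y) : g ∘ (a *: f) = a *: (g ∘ f).
Proof. by have := comp_linr g a f 0; rewrite comp0r !addr0. Qed.

Lemma compNl X Y Z (g : hom Y Z) (f : hom X Y) : (- g) ∘ f = - (g ∘ f).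
Proof. by rewrite -scaleN1r compZl scaleN1r. Qed.

Lemma compNr X Y Z (g : hom Y Z) (f : hom X Y) : g ∘ (- f) = - (g ∘ f).
Proof. by rewrite -scaleN1r compZr scaleN1r. Qed.

Lemma compBl X Y Z (g g' : hom Y Z) (f : hom X Y) :
  (g - g') ∘ f = g ∘ f - g' ∘ f.
Proof. by rewrite compDl compNl. Qed.

Lemma compBr X Y Z (g : hom Y Z) (f f' : hom X Y) :
  g ∘ (f - f') = g ∘ f - g ∘ f'.
Proof. by rewrite compDr compNr. Qed.

Lemma comp_suml X Y Z (I : Type) (r : seq I) (P : pred I)
    (G : I -> hom Y Z) (f : hom X Y) :
  (\sum_(i <- r | P i) G i) ∘ f = \sum_(i <- r | P i) G i ∘ f.
Proof.
elim: r => [|i r IH]; first by rewrite !big_nil comp0l.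
by rewrite !big_cons; case: (P i); rewrite ?compDl IH.
Qed.

Lemma comp_sumr X Y Z (I : Type) (r : seq I) (P : pred I)
    (g : hom Y Z) (G : I -> hom X Y) :
  g ∘ (\sum_(i <- r | P i) G i) = \sum_(i <- r | P i) g ∘ G i.
Proof.
elim: r => [|i r IH]; first by rewrite !big_nil comp0r.
by rewrite !big_cons; case: (P i); rewrite ?compDr IH.
Qed.

Lemma is_zero_idm X : is_zero X <-> idm X = 0.
Proof.
split=> [zX|e Y]; first by have [z _] := zX X; apply: z.
by split=> f; [rewrite -[f]comp_idr | rewrite -[f]comp_idl];
  rewrite e ?comp0r ?comp0l.
Qed.

Lemma iso_idm X : is_iso (idm X).
Proof. by exists (idm X); rewrite comp_idl. Qed.

Lemma iso_comp X Y Z (g : hom Y Z) (f : hom X Y) :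
  is_iso g -> is_iso f -> is_iso (g ∘ f).
Proof.
move=> [g' [e1 e2]] [f' [e3 e4]]; exists (f' ∘ g'); split.
  by rewrite -comp_assoc (comp_assoc g') e1 comp_idl e3.
by rewrite -comp_assoc (comp_assoc f) e4 comp_idl e2.
Qed.

(** Neither composite has to be an identity: an invertible one already provides
    a one-sided inverse. *)
Lemma iso_of_inverses X Y (f : hom X Y) (l r : hom Y X) :
  is_iso (l ∘ f) -> is_iso (f ∘ r) -> is_iso f.
Proof.
move=> [l' [e1 _]] [r' [_ e2]]; exists (l' ∘ l).
rewrite -comp_assoc; split => //.
suff -> : l' ∘ l = r ∘ r' by rewrite comp_assoc.
rewrite -[l' ∘ l]comp_idr -e2 !comp_assoc -(comp_assoc l' l f) e1.
by rewrite comp_idl.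
Qed.

Lemma iso_scale X Y a (f : hom X Y) : a != 0 -> is_iso f -> is_iso (a *: f).
Proof.
move=> a0 [g [e1 e2]]; exists (a^-1 *: g).
by rewrite !compZl !compZr !scalerA mulVf // mulfV // !scale1r.
Qed.

Lemma isomorphic_refl X : isomorphic X X.
Proof. by exists (idm X); apply: iso_idm. Qed.

Lemma isomorphic_sym X Y : isomorphic X Y -> isomorphic Y X.
Proof. by move=> [f [g [e1 e2]]]; exists g, f. Qed.

Lemma isomorphic_trans X Y Z :
  isomorphic X Y -> isomorphic Y Z -> isomorphic X Z.
Proof. by move=> [f fi] [g gi]; exists (g ∘ f); apply: iso_comp. Qed.

Definition orth X Y : Prop := forall f : hom X Y, f = 0.

Definition retract X Y : Prop := exists (i : hom X Y) (p : hom Y X), p ∘ i = idm X.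

Lemma iso_retract X Y : isomorphic X Y -> retract Y X.
Proof. by move=> [f [g [_ e]]]; exists g, f. Qed.

Lemma orth_retract X X' Y Y' :
  retract X' X -> retract Y' Y -> orth X Y -> orth X' Y'.
Proof.
move=> [f' [f e1]] [g' [g e2]] o u.
have -> : u = g ∘ (g' ∘ u ∘ f) ∘ f'.
  by rewrite !comp_assoc e2 comp_idl -comp_assoc e1 comp_idr.
by rewrite (o (g' ∘ u ∘ f)) comp0r comp0l.
Qed.

Lemma orth_iso X X' Y Y' :
  isomorphic X X' -> isomorphic Y Y' -> orth X Y -> orth X' Y'.
Proof. by move=> /iso_retract rX /iso_retract; apply: orth_retract. Qed.

Lemma local_indecomposable X : local_end X -> indecomposable X.
Proof.
move=> [n0 loc]; split; first by move/is_zero_idm.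
move=> A B [iA [iB [pA [pB [eA eB e1 e2 e3]]]]].
have [[g [_ eg]]|[g [_ eg]]] : is_iso (iA ∘ pA) \/ is_iso (iB ∘ pB).
  by apply: loc; rewrite e3; apply: iso_idm.
  right; apply/is_zero_idm; rewrite -eB -[pB]comp_idr -eg.
  by rewrite !comp_assoc e1 !comp0l.
left; apply/is_zero_idm; rewrite -eA -[pA]comp_idr -eg.
by rewrite !comp_assoc e2 !comp0l.
Qed.

(** The idempotent [i ∘ p] or its complement is invertible, and the complement
    kills [i]. *)
Lemma local_retract_iso X B (i : hom B X) (p : hom X B) :
  local_end X -> idm B <> 0 -> p ∘ i = idm B -> is_iso i.
Proof.
move=> [_ loc] B0 pi; have [] : is_iso (i ∘ p) \/ is_iso (idm X - i ∘ p).
- by apply: loc; rewrite addrC subrK; apply: iso_idm.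
- by apply: (@iso_of_inverses _ _ i p p); rewrite pi; apply: iso_idm.
move=> [s [e _]]; case: B0; rewrite -pi.
have -> : i = s ∘ ((idm X - i ∘ p) ∘ i) by rewrite comp_assoc e comp_idl.
by rewrite compBl comp_idl -comp_assoc pi comp_idr subrr !comp0r.
Qed.

Lemma local_end_iso X Y :
  isomorphic X Y -> local_end X -> local_end Y.
Proof.
move=> [p [q [e1 e2]]] [n0 loc].
have pi : is_iso p by exists q.
have qi : is_iso q by exists p.
split=> [e|f g].
  by apply: n0; rewrite -e1 -[p]comp_idl e comp0l comp0r.
have tr (f0 : hom Y Y) : is_iso (q ∘ f0 ∘ p) -> is_iso f0.
  move=> i; have -> : f0 = p ∘ (q ∘ f0 ∘ p) ∘ q.
    by rewrite !comp_assoc e2 comp_idl -comp_assoc e2 comp_idr.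
  by do 2!apply: iso_comp => //.
move=> i; have [/tr|/tr] : is_iso (q ∘ f ∘ p) \/ is_iso (q ∘ g ∘ p).
- apply: loc; rewrite -compDl -compDr.
  by do 2!apply: iso_comp => //.
- by left.
- by right.
Qed.

(** The endomorphism ring is k or the ring of dual numbers k[x]/(x^2); the
    first case is encoded by x = 0, so that both are treated at once. *)
Definition dual_end X (x : hom X X) : Prop :=
  [/\ idm X <> 0, x ∘ x = 0
    & forall v : hom X X, exists a c, v = a *: idm X + c *: x].

Lemma dual_end_iso X (x v : hom X X) a c :
  dual_end x -> v = a *: idm X + c *: x -> a != 0 -> is_iso v.
Proof.
move=> [_ xx _] -> a0; exists (a^-1 *: idm X - (a^-1 * a^-1 * c) *: x).
rewrite !(compDl, compDr, compNl, compNr, compZl, compZr, comp_idl, comp_idr).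
have e : a * (a^-1 * a^-1 * c) = c * a^-1.
  by rewrite !mulrA mulfV // mul1r mulrC.
rewrite xx !scaler0 ?oppr0 ?scaler0 ?subr0 ?addr0 scalerBr scalerN !scalerA e mulfV //.
by rewrite scale1r addrK subrK.
Qed.

Lemma dual_end_noniso X (x v : hom X X) :
  dual_end x -> ~ is_iso v -> exists c, v = c *: x.
Proof.
move=> dx ni; have [_ _ /(_ v)[a [c e]]] := dx.
have [a0|a0] := eqVneq a 0; last by case: ni; apply: dual_end_iso e a0.
by exists c; rewrite e a0 scale0r add0r.
Qed.

Lemma dual_end_not_split_epi X (x : hom X X) c :
  dual_end x -> ~ split_epi (c *: x).
Proof.
move=> [n0 xx _] [s e]; apply: n0.
have x0 : c *: x = 0.
  rewrite -[c *: x]comp_idr -e comp_assoc compZl !compZr xx.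
  by rewrite !scaler0 comp0l.
by rewrite -e x0 comp0l.
Qed.

Lemma dual_end_niso X (x : hom X X) c : dual_end x -> ~ is_iso (c *: x).
Proof.
by move=> dx [s [_ e]]; apply: (dual_end_not_split_epi (c := c) dx); exists s.
Qed.

Lemma dual_end_split_epi X (x t : hom X X) :
  dual_end x -> ~ split_epi t -> exists c, t = c *: x.
Proof.
move=> dx ns; apply: dual_end_noniso dx _ => -[s [_ e]].
by apply: ns; exists s.
Qed.

Lemma dual_end_local X (x : hom X X) : dual_end x -> local_end X.
Proof.
move=> dx; have [n0 _ sp] := dx; split=> // f g.
have [a [c ef]] := sp f; have [a' [c' eg]] := sp g.
have [a0|a0] := eqVneq a 0; last by left; apply: dual_end_iso ef a0.
have [a0'|a0'] := eqVneq a' 0; last by right; apply: dual_end_iso eg a0'.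
rewrite ef eg a0 a0' !scale0r !add0r -scalerDl => i.
by case: (dual_end_niso dx i).
Qed.

Lemma scalar_end_scalar X v : dual_end (0 : hom X X) -> exists a, v = a *: idm X.
Proof.
by move=> [_ _ /(_ v)[a [c ->]]]; exists a; rewrite scaler0 addr0.
Qed.

Lemma scalar_end_iso X (v : hom X X) :
  dual_end (0 : hom X X) -> v <> 0 -> is_iso v.
Proof.
move=> d v0; apply: NNPP => /(dual_end_noniso d)[c e].
by apply: v0; rewrite e scaler0.
Qed.

Lemma scalar_end_isomorphic X Y :
  isomorphic X Y -> dual_end (0 : hom X X) -> dual_end (0 : hom Y Y).
Proof.
move=> [f [g [e1 e2]]] d; have [n0 _ _] := d; split.
- by move=> e; apply: n0; rewrite -e1 -[f]comp_idl e comp0l comp0r.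
- by rewrite comp0l.
move=> v; have [a e] := scalar_end_scalar (g ∘ v ∘ f) d.
exists a, 0; rewrite scaler0 addr0 -[idm Y]e2.
have -> : v = f ∘ (g ∘ v ∘ f) ∘ g.
  by rewrite !comp_assoc e2 comp_idl -comp_assoc e2 comp_idr.
by rewrite e compZr comp_idr compZl.
Qed.

End LinearCategory.

(** * Fully faithful functors and equivalences *)

Section Functors.
Variables (k : fieldType) (C D : linCat k) (F : functor C D).

Lemma fmapD X Y (f g : hom X Y) : fmap F (f + g) = fmap F f + fmap F g.
Proof. by have := fmap_lin F 1 f g; rewrite !scale1r. Qed.

Lemma fmap0 X Y : fmap F (0 : hom X Y) = 0.
Proof. by apply: (addIr (fmap F 0)); rewrite -fmapD !add0r. Qed.

Lemma fmapZ X Y a (f : hom X Y) : fmap F (a *: f) = a *: fmap F f.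
Proof. by have := fmap_lin F a f 0; rewrite fmap0 !addr0. Qed.

Lemma fmap_iso X Y (f : hom X Y) : is_iso f -> is_iso (fmap F f).
Proof.
by move=> [g [e1 e2]]; exists (fmap F g); rewrite -!fmap_comp e1 e2 !fmap_id.
Qed.

Lemma fmap_isomorphic X Y : isomorphic X Y -> isomorphic (F X) (F Y).
Proof. by move=> [f fi]; exists (fmap F f); apply: fmap_iso. Qed.

Lemma fmap_retract X Y : retract X Y -> retract (F X) (F Y).
Proof.
by move=> [i [p e]]; exists (fmap F i), (fmap F p); rewrite -fmap_comp e fmap_id.
Qed.

Definition fully_faithful : Prop :=
  (forall (X Y : C) (f g : hom X Y), fmap F f = fmap F g -> f = g) /\
  (forall (X Y : C) (g : hom (F X) (F Y)), exists f : hom X Y, fmap F f = g).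

Hypothesis ff : fully_faithful.

Lemma orth_fmap X Y : orth (F X) (F Y) <-> orth X Y.
Proof.
split=> o f; first by apply: (proj1 ff); rewrite (o (fmap F f)) fmap0.
by have [g <-] := proj2 ff _ _ f; rewrite (o g) fmap0.
Qed.

Lemma dual_end_fmap X (x : hom X X) : dual_end x -> dual_end (fmap F x).
Proof.
move=> [n0 xx sp]; split.
- by rewrite -fmap_id -(fmap0 X X) => /(proj1 ff).
- by rewrite -fmap_comp xx fmap0.
move=> v; have [w <-] := proj2 ff _ _ v; have [a [c ->]] := sp w.
by exists a, c; rewrite fmapD !fmapZ fmap_id.
Qed.

End Functors.

Section Equivalences.
Variable k : fieldType.
Implicit Types C D : linCat k.

Lemma nat_iso_isomorphic C D (F G : functor C D) (p : natIso F G) X :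
  isomorphic (F X) (G X).
Proof.
by exists (nat_fwd p X), (nat_bwd p X); split; [apply: nat_fwdK | apply: nat_bwdK].
Qed.

Lemma retract_faithful C D (F : functor C D) (G : functor D C)
    (p : natIso (functor_comp G F) (functor_id C)) (X Y : C) (f g : hom X Y) :
  fmap F f = fmap F g -> f = g.
Proof.
move=> e; have := nat_natural p f; rewrite /= e.
have -> := nat_natural p g => /= /(congr1 (fun u => u ∘ nat_bwd p X)).
by rewrite -!comp_assoc (nat_bwdK p) !comp_idr => ->.
Qed.

Lemma equivalence_fully_faithful C D (F : functor C D) (G : functor D C)
    (p : natIso (functor_comp G F) (functor_id C))
    (q : natIso (functor_comp F G) (functor_id D)) : fully_faithful F.
Proof.
split=> [X Y f g|X Y g]; first exact: retract_faithful p _ _ _ _.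
exists (nat_fwd p Y ∘ fmap G g ∘ nat_bwd p X).
apply: (@retract_faithful D C G F q).
set f := _ ∘ _.
have e : nat_fwd p Y ∘ fmap G (fmap F f) = nat_fwd p Y ∘ fmap G g.
  rewrite (nat_natural p f) /= /f -(comp_assoc _ (nat_bwd p X)) (nat_fwdK p) /=.
  by rewrite comp_idr.
have := congr1 (fun u => nat_bwd p Y ∘ u) e.
by rewrite !comp_assoc (nat_fwdK p) !comp_idl.
Qed.

End Equivalences.

(** * Shifts and exactness of distinguished triangles *)

Section Triangles.
Variables (k : fieldType) (T : triCat k).
Implicit Types X Y Z A B W : T.

Lemma shift_ff : fully_faithful (shift T).
Proof. exact: equivalence_fully_faithful (shiftK T) (unshiftK T). Qed.

Lemma unshift_ff : fully_faithful (unshift T).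
Proof. exact: equivalence_fully_faithful (unshiftK T) (shiftK T). Qed.

Lemma shift_unshift X : isomorphic (shift T (unshift T X)) X.
Proof. exact: nat_iso_isomorphic (unshiftK T) X. Qed.

Lemma unshift_shift X : isomorphic (unshift T (shift T X)) X.
Proof. exact: nat_iso_isomorphic (shiftK T) X. Qed.

Lemma orth_shift X Y : orth (shift T X) Y <-> orth X (unshift T Y).
Proof.
rewrite -(orth_fmap shift_ff X (unshift T Y)); split; apply: orth_iso.
- exact: isomorphic_refl.
- exact/isomorphic_sym/shift_unshift.
- exact: isomorphic_refl.
- exact/shift_unshift.
Qed.

Lemma orth_unshift X Y : orth (unshift T X) Y <-> orth X (shift T Y).
Proof.
rewrite -(orth_fmap unshift_ff X (shift T Y)); split; apply: orth_iso.
- exact: isomorphic_refl.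
- exact/isomorphic_sym/unshift_shift.
- exact: isomorphic_refl.
- exact/unshift_shift.
Qed.

Lemma shiftz_succ X i : isomorphic (shift T (shiftz X i)) (shiftz X (i + 1)).
Proof.
case: i => [n|[|n]].
- have -> : Posz n + 1 = n.+1 by lia.
  apply: isomorphic_refl.
- exact: shift_unshift.
- have -> : Negz n.+1 + 1 = Negz n by lia.
  exact: shift_unshift.
Qed.

Lemma shiftz_pred X i : isomorphic (unshift T (shiftz X i)) (shiftz X (i - 1)).
Proof.
case: i => [[|n]|n].
- exact: isomorphic_refl.
- have -> : Posz n.+1 - 1 = n by lia.
  exact: unshift_shift.
- have -> : Negz n - 1 = Negz n.+1 by lia.
  apply: isomorphic_refl.
Qed.

(** Shifting both objects leaves Hom unchanged; only its vanishing matters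
    below, which avoids transporting maps along the isomorphisms that relate the
    iterated shifts. *)
Lemma orth_shiftz X Y i : orth (shiftz X i) Y <-> orth X (shiftz Y (- i)).
Proof.
have up n : forall Z, orth (iter n (shift T) X) Z <->
                      orth X (iter n (unshift T) Z).
  elim: n => // n IH Z; rewrite [iter _ _ X]iterS iterSr -IH.
  exact: orth_shift.
have dn n : forall Z, orth (iter n (unshift T) X) Z <->
                      orth X (iter n (shift T) Z).
  elim: n => // n IH Z; rewrite [iter _ _ X]iterS iterSr -IH.
  exact: orth_unshift.
by case: i => [[|n]|n] //=; [apply: (up n.+1) | apply: (dn n.+1)].
Qed.

Lemma shiftz_retract X Y i : retract X Y -> retract (shiftz X i) (shiftz Y i).
Proof.
by move=> r; case: i => n; elim: n => [|n IH] //=; apply: fmap_retract.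
Qed.

Lemma dist_comp0 X Y Z (f : hom X Y) (g : hom Y Z) (h : hom Z (shift T X)) :
  dist f g h -> g ∘ f = 0.
Proof.
move=> D; have [O zO] := has_zero T.
have [c [<- _]] : exists c : hom O Z, c ∘ (0 : hom X O) = g ∘ f /\
    fmap (shift T) (idm X) ∘ 0 = h ∘ c.
  by apply: (dist_mor (dist_id X zO) D); rewrite comp_idr.
exact: comp0r.
Qed.

(** Exactness of Hom(W, -): the lift is the third component of a map from the
    rotated triangle W -> 0 -> W[1]. *)
Lemma dist_lift W X Y Z (f : hom X Y) (g : hom Y Z) (h : hom Z (shift T X))
    (u : hom W Y) :
  dist f g h -> g ∘ u = 0 -> exists v : hom W X, u = f ∘ v.
Proof.
move=> D gu; have [O zO] := has_zero T.
have D1 := (proj1 (dist_rot _ _ _)) (dist_id W zO).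
have D2 := (proj1 (dist_rot _ _ _)) D.
have [c [_]] := dist_mor (a := u) (b := 0) D1 D2 (etrans (comp0l _ _) (esym gu)).
have [v <-] := proj2 shift_ff _ _ c.
rewrite fmap_id compNr compNl comp_idr -fmap_comp => /oppr_inj.
by move/(proj1 shift_ff); exists v.
Qed.

(** Exactness of Hom(-, W): the extension is the third component of a map to
    the triangle O -> W -> W with O a zero object. *)
Lemma dist_extend W X Y Z (f : hom X Y) (g : hom Y Z) (h : hom Z (shift T X))
    (u : hom Y W) :
  dist f g h -> u ∘ f = 0 -> exists v : hom Z W, u = v ∘ g.
Proof.
move=> D uf; have [O zO] := has_zero T.
have zsO : is_zero (shift T O).
  by apply/is_zero_idm; rewrite -fmap_id (proj1 (is_zero_idm O) zO) fmap0.
have D1 : dist (0 : hom O W) (idm W) (0 : hom W (shift T O)).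
  by apply/dist_rot; rewrite fmap0 oppr0; apply: dist_id.
have [v [e _]] := dist_mor (a := 0 : hom X O) (b := u) D D1
  (etrans uf (esym (comp0l _ _))).
by exists v; rewrite e comp_idl.
Qed.

(** The difference of such a [c] and the identity factors through [h] on one
    side and is killed by it on the other, so it squares to zero. The triangle is
    represented by its extension property along [g], which a sum of triangles
    has before it is known to be distinguished. *)
Lemma triangle_end_iso W Y Z (g : hom Y Z) (h : hom Z W) (c : hom Z Z) :
  (forall n : hom Z Z, n ∘ g = 0 -> exists m, n = m ∘ h) ->
  c ∘ g = g -> h ∘ c = h -> is_iso c.
Proof.
move=> ex cg hc; pose n := c - idm Z.
have [m e] : exists m, n = m ∘ h.
  by apply: ex; rewrite /n compBl cg comp_idl subrr.
have hn : h ∘ n = 0 by rewrite /n compBr hc comp_idr subrr.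
have nn : n ∘ n = 0 by rewrite {1}e -comp_assoc hn comp0r.
have -> : c = idm Z + n by rewrite /n addrC subrK.
exists (idm Z - n); split.
  by rewrite compDr comp_idr compBl comp_idl nn subr0 subrK.
by rewrite compBr comp_idr compDl comp_idl nn addr0 addrK.
Qed.

(** The cone of [h] gives the rotated triangle; its other two maps come from
    X -> Y -> Z because the shift is full, with the signs of the rotation axiom. *)
Lemma dist_of_last X Z (h : hom Z (shift T X)) :
  exists (Y : T) (f : hom X Y) (g : hom Y Z), dist f g h.
Proof.
have [C [b [c D]]] := dist_cone h.
have [e [e' [e1 e2]]] := shift_unshift C.
have [f ef] := proj2 shift_ff _ _ (- (e' ∘ b)).
have [g eg] := proj2 shift_ff _ _ (- (c ∘ e)).
exists (unshift T C), f, g; apply/dist_rot/dist_rot; rewrite ef eg !opprK.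
apply: (dist_iso (a := idm _) (b := idm _) (c := e')) D;
  [exact: iso_idm | exact: iso_idm | | | |].
- by exists e.
- by rewrite comp_idl comp_idr.
- by rewrite comp_idr.
- by rewrite fmap_id comp_idl -comp_assoc e2 comp_idr.
Qed.

Lemma last_map_iso_of_zero_middle X Y Z (f : hom X Y) (g : hom Y Z)
    (h : hom Z (shift T X)) : dist f g h -> is_zero Y -> is_iso h.
Proof.
move=> D zY; have D' := (proj1 (dist_rot _ _ _)) D.
have g0 : g = 0 by have [z _] := zY Z; apply: z.
have f0 : f = 0 by have [_ z] := zY X; apply: z.
have [q eq] : exists q, idm Z = q ∘ h.
  by apply: (dist_extend D'); rewrite g0 comp0r.
have [r er] : exists r, idm (shift T X) = h ∘ r.
  by apply: (dist_lift (proj1 (dist_rot _ _ _) D'));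
    rewrite f0 fmap0 oppr0 comp0l.
by apply: (@iso_of_inverses _ _ _ _ h q r);
  rewrite -?eq -?er; apply: iso_idm.
Qed.

(** If Y were a sum of two nonzero objects, both components of [f] would be
    nonzero (a vanishing one makes a summand of Y a summand of Z, hence all of Z,
    and yields a section of [g]), so they would span two lines in Hom(X, Y). *)
Lemma middle_indecomposable X Y Z (f : hom X Y) (g : hom Y Z)
    (h : hom Z (shift T X)) :
  dist f g h -> local_end Z -> h <> 0 -> ~ is_iso h ->
  (forall u : hom X Y, exists c, u = c *: f) -> indecomposable Y.
Proof.
move=> D locZ h0 hni line; have D' := (proj1 (dist_rot _ _ _)) D.
split; first by move/(last_map_iso_of_zero_middle D).
have comp_nz A (i : hom A Y) (p : hom Y A) :
    p ∘ i = idm A -> p ∘ f = 0 -> is_zero A.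
  move=> pi pf; have [q eq] := dist_extend D pf.
  have qg : q ∘ (g ∘ i) = idm A by rewrite comp_assoc -eq.
  apply: NNPP => nzA; have A0 : idm A <> 0 by move/is_zero_idm.
  have [r [_ e]] := local_retract_iso locZ A0 qg.
  apply: h0; rewrite -[h]comp_idr -e !comp_assoc (dist_comp0 D').
  by rewrite !comp0l.
move=> A B [iA [iB [pA [pB [eA eB e1 e2 _]]]]].
have [c e] := line (iA ∘ (pA ∘ f)).
have [c0|c0] := eqVneq c 0.
  left; apply: (comp_nz A iA pA eA).
  by rewrite -[pA ∘ f]comp_idl -eA -comp_assoc e c0 scale0r comp0r.
right; apply: (comp_nz B iB pB eB); apply: (scalerI c0).
by rewrite -compZr -e comp_assoc e1 comp0l scaler0.
Qed.

End Triangles.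

(** * Serre duality and Auslander-Reiten triangles *)

Section LinearForms.
Variables (k : fieldType) (V : lmodType k).

Definition coord_form n (f : {linear V -> 'rV[k]_n}) (j : 'I_n) : V -> k^o :=
  fun v => f v 0 j.

Fact coord_form_is_linear n (f : {linear V -> 'rV[k]_n}) j :
  linear (coord_form f j).
Proof. by move=> a u v; rewrite /coord_form linearP !mxE. Qed.

HB.instance Definition _ n (f : {linear V -> 'rV[k]_n}) j :=
  GRing.isLinear.Build k V k^o _ (coord_form f j) (coord_form_is_linear f j).

Lemma linear_form_separates n (v : V) :
  lin_iso V 'rV[k]_n -> v <> 0 -> exists l : {linear V -> k^o}, l v != 0.
Proof.
move=> [f bf] v0.
have [j fj] : exists j, f v 0 j != 0.
  apply/existsP; apply: contra_notT v0; rewrite negb_exists => /forallP z.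
  apply: (bij_inj bf); rewrite linear0; apply/rowP => j.
  by rewrite mxE; apply/eqP; have := z j; rewrite negbK.
by exists (coord_form f j : {linear V -> k^o}).
Qed.

Lemma form_scale (l : {linear V -> k^o}) a v : l (a *: v) = a * l v.
Proof. exact: linearZ. Qed.

Lemma kernel_incl_proportional (l m : {linear V -> k^o}) :
  (forall v, l v = 0 -> m v = 0) -> exists c : k, forall v, m v = c * l v.
Proof.
move=> incl; have [[v0 n0]|z] := classic (exists v, l v != 0).
  exists (m v0 / l v0) => v; apply/eqP; rewrite -subr_eq0; apply/eqP.
  have := incl (v - (l v / l v0) *: v0); rewrite !linearB /= !form_scale.
  by rewrite divfK // subrr => /(_ erefl) <-; rewrite mulrC mulrA mulrAC.
exists 0 => v; rewrite mul0r; apply: incl; apply/eqP; apply: contra_notT z.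
by exists v.
Qed.

End LinearForms.

Section SerreDuality.
Variables (k : fieldType) (T : triCat k) (S : serreFunctor T).
Hypothesis Thom : hom_finite T.
Implicit Types X Y W E : T.

Lemma serre_ff : fully_faithful S.
Proof.
by have [G [[p] [q]]] := serre_equiv S; apply: equivalence_fully_faithful p q.
Qed.

Lemma serre_phi_idm X Y (f : hom X Y) (u : hom Y (S X)) :
  serre_phi S f u = serre_phi S (idm X) (u ∘ f).
Proof. by rewrite -serre_natr comp_idr. Qed.

Lemma serre_phi0 X Y (u : hom Y (S X)) : serre_phi S (0 : hom X Y) u = 0.
Proof. by rewrite serre_phi_idm comp0r linear0. Qed.

Lemma serre_phiZ X Y a (f : hom X Y) (u : hom Y (S X)) :
  serre_phi S (a *: f) u = a * serre_phi S f u.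
Proof. by rewrite serre_phi_idm compZr form_scale -serre_phi_idm. Qed.

Lemma serre_phi_inj X Y (f g : hom X Y) :
  serre_phi S f =1 serre_phi S g -> f = g.
Proof.
move=> e; have [f0 [_ uniq]] := serre_bij (serre_phi S g).
by rewrite -(uniq g) // -(uniq f).
Qed.

Lemma serre_nondeg_left X Y (f : hom X Y) :
  f <> 0 -> exists u : hom Y (S X), u ∘ f <> 0.
Proof.
move=> f0; apply: NNPP => none; apply: f0.
apply: serre_phi_inj => u; rewrite serre_phi0 serre_phi_idm.
suff -> : u ∘ f = 0 by rewrite linear0.
by apply: NNPP => nz; apply: none; exists u.
Qed.

Lemma serre_nondeg_right X Y (u : hom Y (S X)) :
  (forall f : hom X Y, serre_phi S f u = 0) -> u = 0.
Proof.
move=> z; apply: NNPP => u0; have [n iso] := Thom Y (S X).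
have [l lu] := linear_form_separates iso u0.
have [f [e _]] := serre_bij l.
by move: lu; rewrite -(e u) z eqxx.
Qed.

Lemma serre_nondeg_right_comp X Y (u : hom Y (S X)) :
  u <> 0 -> exists f : hom X Y, u ∘ f <> 0.
Proof.
move=> u0; apply: NNPP => none; apply: u0; apply: serre_nondeg_right => f.
rewrite serre_phi_idm; suff -> : u ∘ f = 0 by rewrite linear0.
by apply: NNPP => nz; apply: none; exists f.
Qed.

(** A linear form on End(E) that kills the radical but not the identity is
    represented by a map E -> SE; by naturality it is annihilated by every map
    to E that is not a split epimorphism. *)
Lemma almost_vanishing_map E (x : hom E E) : dual_end x ->
  exists h : hom E (S E), h <> 0 /\
    forall W (t : hom W E), ~ split_epi t -> h ∘ t = 0.
Proof.
move=> dx; have [n0 xx _] := dx.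
have [h [h1 h2]] : exists h : hom E (S E),
    serre_phi S x h = 0 /\ serre_phi S (idm E) h <> 0.
  apply: NNPP => none.
  have [c e] : exists c : k, forall h : hom E (S E),
      serre_phi S (idm E) h = c * serre_phi S x h.
    apply: kernel_incl_proportional => h xh; apply: NNPP => ih.
    by apply: none; exists h.
  apply: n0; have e1 : idm E = c *: x.
    by apply: (serre_phi_inj) => h; rewrite e serre_phiZ.
  by rewrite -[idm E]comp_idl e1 compZl compZr xx !scaler0.
exists h; split=> [h0|W t nst]; first by apply: h2; rewrite h0 linear0.
apply: serre_nondeg_right => f; rewrite serre_phi_idm -comp_assoc.
rewrite -serre_phi_idm.
have [c ->] : exists c, t ∘ f = c *: x.
  apply: dual_end_split_epi dx _ => -[s e].
  by apply: nst; exists (f ∘ s); rewrite comp_assoc.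
by rewrite serre_phiZ h1 mulr0.
Qed.

(** Under these hypotheses Hom(τE, Y) is the line spanned by the first map of
    the Auslander-Reiten triangle τE -> Y -> E -> SE: the first one makes every
    map τE -> Y factor through τE, and the second one says that the radical of
    End(τE) dies in Y. *)
Lemma at_mouth_criterion E (x : hom E E) : dual_end x ->
  (forall h : hom E (S E), h <> 0 ->
     forall w : hom (unshift T (S E)) E, h ∘ w = 0 -> w = 0) ->
  (forall h : hom E (S E), h <> 0 -> ~ is_iso h ->
     exists y : hom (S E) E, fmap S x = h ∘ y) ->
  x <> 0 \/ ~ isomorphic E (S E) ->
  at_mouth E.
Proof.
move=> dx H1 H2 H3; have [h [h0 hAR]] := almost_vanishing_map dx.
have hni : ~ is_iso h.
  move=> hi; case: H3 => [x0|]; last by apply; exists h.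
  have hx : h ∘ x = 0.
    by apply: hAR; rewrite -[x]scale1r; apply: dual_end_not_split_epi.
  by case: hi => h' [e _]; apply: x0; rewrite -[x]comp_idl -e -comp_assoc hx comp0r.
have indE := local_indecomposable (dual_end_local dx).
pose X := unshift T (S E).
have dX : dual_end (fmap (unshift T) (fmap S x)).
  exact/(dual_end_fmap (@unshift_ff k T))/(dual_end_fmap serre_ff).
pose p := nat_fwd (unshiftK T) (S E); pose q := nat_bwd (unshiftK T) (S E).
have pq : p ∘ q = idm (S E) by apply: nat_bwdK.
have qp : q ∘ p = idm (shift T X) by apply: nat_fwdK.
have qi : is_iso q by exists p.
have pi : is_iso p by exists q.
have pqh : p ∘ (q ∘ h) = h by rewrite comp_assoc pq comp_idl.
have qh0 : q ∘ h <> 0 by move=> e; apply: h0; rewrite -pqh e comp0r.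
have qhni : ~ is_iso (q ∘ h).
  by move=> i; apply: hni; rewrite -pqh; apply: iso_comp.
have [Y [f [g D]]] := dist_of_last (q ∘ h : hom E (shift T X)).
have D' := (proj1 (dist_rot _ _ _)) D.
split=> //; exists X, Y, f, g, (q ∘ h); split.
  split=> //; first exact: local_indecomposable (dual_end_local dX).
  move=> W t nst; apply: (dist_lift D').
  by rewrite -comp_assoc hAR ?comp0r.
apply: (middle_indecomposable D) => //; first exact: dual_end_local dx.
have frad : f ∘ fmap (unshift T) (fmap S x) = 0.
  have [y ey] := H2 h h0 hni; apply: (proj1 (@shift_ff k T)).
  (* The shift of the radical factors through [q ∘ h] by naturality, and [q ∘ h]
     is followed by the shift of [f] in the rotated triangle. *)
  pose r := fmap (shift T) (fmap (unshift T) (fmap S x)).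
  have pr : p ∘ r = fmap S x ∘ p := nat_natural (unshiftK T) (fmap S x).
  have er : r = q ∘ h ∘ (y ∘ p).
    have -> : r = q ∘ (p ∘ r) by rewrite comp_assoc qp comp_idl.
    by rewrite pr ey !comp_assoc.
  rewrite fmap_comp fmap0 -/r er.
  have := dist_comp0 (proj1 (dist_rot _ _ _) D').
  rewrite compNl => /eqP; rewrite oppr_eq0 => /eqP e.
  by rewrite (comp_assoc (fmap _ f)) e comp0l.
have hg : h ∘ g = 0 by rewrite -pqh -comp_assoc (dist_comp0 D') comp0r.
move=> u; have gu : g ∘ u = 0 -> exists c, u = c *: f.
  move=> /(dist_lift D)[v ->]; have [_ _ /(_ v)[a [c ->]]] := dX.
  by exists a; rewrite compDr !compZr comp_idr frad scaler0 addr0.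
by apply: gu; apply: (H1 h h0); rewrite comp_assoc hg comp0l.
Qed.

End SerreDuality.

(** * Low-dimensional Hom spaces *)

Section GradedHom.
Variables (k : fieldType) (T : triCat k).
Implicit Types X Y E F : T.

Lemma orth_of_gr0 X Y i : lin_iso (hom_gr X Y i) 'rV[k]_0 -> orth X (shiftz Y i).
Proof.
by move=> [f bf] u; apply: (bij_inj bf); rewrite [LHS]thinmx0 [RHS]thinmx0.
Qed.

Lemma orth_of_sum0 X Y i :
  lin_iso (hom_gr X Y i) ('rV[k]_0 * 'rV[k]_0)%type -> orth X (shiftz Y i).
Proof.
move=> [f bf] u; apply: (bij_inj bf); rewrite [LHS]surjective_pairing.
by rewrite [RHS]surjective_pairing; congr pair;
  rewrite [LHS]thinmx0 [RHS]thinmx0.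
Qed.

(** A single homogeneous injective coordinate is enough, so that the same
    argument serves k and k + 0. *)
Lemma scalar_end_of_coord E (phi : hom E E -> k) (v : hom E E) :
  injective phi -> (forall a u, phi (a *: u) = a * phi u) -> v <> 0 ->
  dual_end (0 : hom E E).
Proof.
move=> inj hom1 v0.
have i0 : idm E <> 0 by move=> e; apply: v0; rewrite -[v]comp_idl e comp0l.
have phi0 : phi (idm E) != 0.
  apply/eqP => e; apply: i0; apply: inj; rewrite e.
  by rewrite -(scale0r (idm E)) hom1 mul0r.
split=> // [|w]; first by rewrite comp0l.
exists (phi w / phi (idm E)), 0; rewrite scaler0 addr0; apply: inj.
by rewrite hom1 divfK.
Qed.

Lemma scalar_end_of_line E :
  lin_iso (hom E E) 'rV[k]_1 -> dual_end (0 : hom E E).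
Proof.
move=> [f bf]; have [g fg gf] := bf.
apply: (@scalar_end_of_coord E (fun u => f u 0 0) (g (const_mx 1))).
- move=> u v e; apply: (bij_inj bf); apply/rowP => j.
  by rewrite (ord1 j).
- by move=> a u; rewrite linearZ mxE.
- move=> /(congr1 f); rewrite gf linear0 => /rowP/(_ 0).
  by rewrite !mxE => /eqP; rewrite oner_eq0.
Qed.

Lemma scalar_end_of_line_sum0 E :
  lin_iso (hom E E) ('rV[k]_1 * 'rV[k]_0)%type -> dual_end (0 : hom E E).
Proof.
move=> [f bf]; have [g fg gf] := bf.
apply: (@scalar_end_of_coord E (fun u => (f u).1 0 0) (g (const_mx 1, 0))).
- move=> u v e; apply: (bij_inj bf); rewrite [LHS]surjective_pairing.
  rewrite [RHS]surjective_pairing; congr pair; last first.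
    by rewrite [LHS]thinmx0 [RHS]thinmx0.
  by apply/rowP => j; rewrite (ord1 j).
- by move=> a u; rewrite linearZ mxE.
- move=> /(congr1 f); rewrite gf linear0 => /(congr1 fst)/rowP/(_ 0).
  by rewrite !mxE => /eqP; rewrite oner_eq0.
Qed.

End GradedHom.

Section Plane.
Variables (k : fieldType) (V : lmodType k).
Hypothesis plane : lin_iso V ('rV[k]_1 * 'rV[k]_1)%type.

Definition independent (u w : V) : Prop :=
  forall a b : k, a *: u + b *: w = 0 -> a = 0 /\ b = 0.

Lemma plane_coord : exists (x y : V -> k) (mk : k -> k -> V),
  [/\ forall a b u w, x (a *: u + b *: w) = a * x u + b * x w,
      forall a b u w, y (a *: u + b *: w) = a * y u + b * y w,
      forall u w, x u = x w -> y u = y w -> u = w,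
      forall a b, x (mk a b) = a & forall a b, y (mk a b) = b].
Proof.
have [f [g fg gf]] := plane.
exists (fun u => (f u).1 0 0), (fun u => (f u).2 0 0),
  (fun a b => g (const_mx a, const_mx b)).
split=> [a b u w|a b u w|u w ex ey|a b|a b];
  rewrite ?linearD ?linearZ ?gf ?mxE //.
apply: (can_inj fg); rewrite [LHS]surjective_pairing [RHS]surjective_pairing.
by congr pair; apply/rowP => j; rewrite (ord1 j).
Qed.

Lemma plane_basis (u w v : V) :
  independent u w -> exists a b, v = a *: u + b *: w.
Proof.
have [x [y [mk [xD yD inj xm ym]]]] := plane_coord => ind.
have inj0 t : x t = 0 -> y t = 0 -> t = 0.
  have x0 : x 0 = 0 by have := xD 0 0 0 0; rewrite !scale0r addr0 !mul0r addr0.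
  have y0 : y 0 = 0 by have := yD 0 0 0 0; rewrite !scale0r addr0 !mul0r addr0.
  by move=> xt yt; apply: inj; rewrite ?xt ?yt ?x0 ?y0.
(* Cramer's rule; a vanishing determinant gives explicit linear relations. *)
pose D := x u * y w - y u * x w.
have [D0|D0] := eqVneq D 0; last first.
  exists ((x v * y w - y v * x w) / D), ((x u * y v - y u * x v) / D).
  by apply: inj; rewrite ?xD ?yD; move: D0; rewrite /D => D0; field.
have [yw yu] : y w = 0 /\ - y u = 0.
  apply: ind; apply: inj0; rewrite ?xD ?yD; last by ring.
  by rewrite -[RHS]D0 /D; ring.
have [xw xu] : x w = 0 /\ - x u = 0.
  apply: ind; apply: inj0; rewrite ?xD ?yD; first by ring.
  by rewrite -[RHS]oppr0 -D0 /D; ring.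
have [] : (1 : k) = 0 /\ (0 : k) = 0.
  apply: ind; apply: inj0; rewrite ?xD ?yD !mul0r addr0 mul1r; apply: oppr_inj;
  by rewrite oppr0.
by move/eqP; rewrite oner_eq0.
Qed.

Lemma plane_extend (u : V) : u <> 0 -> exists w, independent u w.
Proof.
have [x [y [mk [xD yD inj xm ym]]]] := plane_coord => u0.
have [x0 y0] : x 0 = 0 /\ y 0 = 0.
  have := xD 0 0 0 0; have := yD 0 0 0 0.
  by rewrite !scale0r addr0 !mul0r addr0.
have [xu|xu] := eqVneq (x u) 0.
  have yu : y u != 0.
    by apply/eqP => yu; apply: u0; apply: inj; rewrite ?x0 ?y0.
  exists (mk 1 0) => a b e; have := xD a b u (mk 1 0).
  have := yD a b u (mk 1 0); rewrite e x0 y0 xm ym xu !mulr0 addr0 add0r mulr1.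
  by move/esym/eqP; rewrite mulf_eq0 (negPf yu) orbF => /eqP -> <-.
exists (mk 0 1) => a b e; have := yD a b u (mk 0 1).
have := xD a b u (mk 0 1); rewrite e x0 y0 xm ym !mulr0 addr0 mulr1.
move/esym/eqP; rewrite mulf_eq0 (negPf xu) orbF => /eqP ->.
by rewrite mul0r add0r.
Qed.

End Plane.

(** A two-dimensional local algebra over an algebraically closed field is the
    ring of dual numbers: the two eigenvalues of a non-scalar element [y] must
    coincide, as otherwise [y - l] and [y - m] would be non-invertible with an
    invertible difference. *)
Lemma local_plane_dual (k : closedFieldType) (C : linCat k) (E : C) :
  lin_iso (hom E E) ('rV[k]_1 * 'rV[k]_1)%type -> local_end E ->
  exists x : hom E E, dual_end x /\ x <> 0.
Proof.
move=> plane [n0 loc]; have [y ind] := plane_extend plane n0.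
have span := fun v => plane_basis plane v ind.
have [a [b eyy]] := span (y ∘ y).
have nz (l : k) : y - l *: idm E <> 0.
  move=> e; have [] := ind (- l) 1; first by rewrite scale1r scaleNr addrC.
  by move=> _ /eqP; rewrite oner_eq0.
have [l el] := solve_monicpoly (fun i => if i == 0 then a else b) (ltn0Sn 1).
(* [l] and [m] are the two roots of X^2 - b X - a. *)
pose m := b - l; have lm : l * m = - a.
  move: el; rewrite big_ord_recr big_ord1 /= expr0 mulr1 expr1 => el.
  by rewrite /m mulrBr -expr2 el; ring.
have prod : (y - l *: idm E) ∘ (y - m *: idm E) = 0.
  rewrite !(compBl, compBr, compZl, compZr, comp_idl, comp_idr) eyy.
  rewrite scalerBr scalerA [m * l]mulrC lm scaleNr opprK.
  by rewrite -[X in X - _]addrA -scalerBl -/m [_ + a *: _]addrC subrr.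
have nil : ~ is_iso (y - l *: idm E).
  move=> [g [e _]]; apply: (nz m).
  by have := congr1 (comp g) prod; rewrite comp_assoc e comp_idl comp0r.
have nim : ~ is_iso (y - m *: idm E).
  move=> [g [_ e]]; apply: (nz l).
  have := congr1 (fun u => u ∘ g) prod.
  by rewrite -comp_assoc e comp_idr comp0l.
have elm : l = m.
  apply/eqP; rewrite -subr_eq0; apply: contraT => lm0.
  case: (loc (y - m *: idm E) (- (y - l *: idm E))) => //.
    rewrite opprB addrC addrA subrK -scalerBl.
    by apply: iso_scale lm0 (iso_idm _).
  move=> [g [e1 e2]]; case: nil; exists (- g).
  by rewrite compNl -compNr e1 compNr -compNl e2.
exists (y - l *: idm E); split; last exact: nz.
split=> // [|v].
  by rewrite {2}elm prod.
have [c [d ->]] := span v; exists (c + d * l), d.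
by rewrite scalerBr scalerA scalerDl addrACA subrr addr0.
Qed.

(** * Cycles with local endomorphism rings *)

Section CyclesAtMouth.
Variables (k : fieldType) (T : triCat k) (S : serreFunctor T).
Hypothesis Thom : hom_finite T.
Implicit Types E F : T.

(** τE = SE[-1] is the shift of F by d - 1. *)
Lemma orth_tau E F d : isomorphic (S E) (shiftz F d) ->
  orth F (shiftz E (1 - d)) -> orth (unshift T (S E)) E.
Proof.
move=> iS; rewrite -opprB -orth_shiftz; apply: orth_iso (isomorphic_refl _).
apply: isomorphic_sym; apply: isomorphic_trans (shiftz_pred F d).
exact: fmap_isomorphic.
Qed.

Lemma ordS_neq_ord n (i : 'I_n) : (3 <= n)%N -> i != ordS i /\ i != ordS (ordS i).
Proof.
move=> n3; have lt_i := ltn_ord i; rewrite -!val_eqE /=.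
have [e|ne] := eqVneq i.+1 n.
  by rewrite e modnn modn_small; lia.
have [e'|ne'] := eqVneq i.+2 n.
  by rewrite (@modn_small i.+1) ?e' ?modnn; lia.
by rewrite (@modn_small i.+1) ?modn_small; lia.
Qed.

(** With three or more objects every map from a shift of E_(i+1) to a
    shift of E_i is zero. Up to a shift τE_i is E_(i+1), so Hom(τE_i, E_i) vanishes, and
    E_i is not isomorphic to SE_i. *)
Lemma exceptional_cycle_at_mouth n (E : 'I_n -> T) :
  (3 <= n)%N -> exceptional_cycle S E -> forall i, at_mouth (E i).
Proof.
move=> n3 [_ E1 [m E2] E3] i; have [ne1 ne2] := ordS_neq_ord i n3.
have o l : orth (E (ordS i)) (shiftz (E i) l).
  exact: orth_of_gr0 (E3 _ _ ne1 ne2 l).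
have dE := scalar_end_of_line (E1 i 0).
apply: (at_mouth_criterion (S := S) Thom dE) => [h _ w _|h _ _|].
- exact: (orth_tau (E2 i) (o _)).
- by exists 0; rewrite comp0r fmap0.
right=> iE; have [n0 _ _] := dE; apply: n0.
have : orth (shiftz (E (ordS i)) (m i)) (E i) by apply/orth_shiftz/o.
move=> oE; apply: (orth_iso _ (isomorphic_refl _) oE).
exact/isomorphic_sym/(isomorphic_trans iE).
Qed.

(** Here τE = E[d - 1] and End(E) = k. Since 1 - d is never equal to d, and equal
    to 0 only for d = 1, there is no nonzero map τE -> E unless d = 1; in that
    case every such map is a scalar multiple of an isomorphism, and a nonzero
    multiple is not killed by a nonzero [h]. *)
Lemma one_cycle_at_mouth_shifted E d : homotopy_like T -> d != 0 ->
  isomorphic (S E) (shiftz E d) ->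
  gr_iso (hom_gr E E) (gr_sum (kgr k 0) (kgr k d)) -> at_mouth E.
Proof.
move=> Thl d0 iS gr; have dE : dual_end (0 : hom E E).
  have := gr 0; rewrite /gr_sum /kgr eqxx eq_sym (negPf d0).
  exact: scalar_end_of_line_sum0.
apply: (at_mouth_criterion (S := S) Thom dE) => [h h0 w hw|h _ _|].
- have [d1|d1] := eqVneq d 1; last first.
    apply: (orth_tau iS); apply: orth_of_sum0; have := gr (1 - d).
    rewrite /gr_sum /kgr subr_eq0 [1 == d]eq_sym (negPf d1).
    suff -> : (1 - d == d) = false by [].
    by apply/eqP; lia.
  have [s [r [rs sr]]] : isomorphic (unshift T (S E)) E.
    rewrite d1 in iS; apply: isomorphic_trans (unshift_shift E).
    exact: fmap_isomorphic.
  have [a ea] := scalar_end_scalar (w ∘ r) dE.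
  have e : w = a *: s.
    by rewrite -[w]comp_idr -rs comp_assoc ea compZl comp_idl.
  rewrite e; have [->|a0] := eqVneq a 0; first by rewrite scale0r.
  case: h0; have := congr1 (fun u => a^-1 *: (u ∘ r)) hw.
  rewrite /= e compZr compZl -comp_assoc sr comp_idr scalerA mulVf //.
  by rewrite scale1r comp0l scaler0.
- by exists 0; rewrite comp0r fmap0.
right=> iE; have ind := local_indecomposable (dual_end_local dE).
exact: (Thl E ind d d0) (isomorphic_trans iE iS).
Qed.

(** With d = 0 the radical of End(SE) is a line, spanned by S(x). An
    Auslander-Reiten map [h] composed with SE = E lies on that line, so S(x)
    factors through [h]. *)
Lemma one_cycle_at_mouth_dual E (x : hom E E) : dual_end x -> x <> 0 ->
  isomorphic (S E) E -> orth E (shift T E) -> at_mouth E.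
Proof.
move=> dx x0 iS o.
apply: (at_mouth_criterion (S := S) Thom dx) => [h _ w _|h h0 hni|].
- exact: (@orth_tau E E 0).
- have [w [w' [e1 e2]]] := iS; have dS := dual_end_fmap (serre_ff S) dx.
  have eh : h = h ∘ w ∘ w' by rewrite -comp_assoc e2 comp_idr.
  have [c e] : exists c, h ∘ w = c *: fmap S x.
    apply: (dual_end_noniso dS) => hwi; apply: hni; rewrite eh.
    by apply: iso_comp => //; exists w.
  have c0 : c != 0.
    by apply/eqP => c0; apply: h0; rewrite eh e c0 scale0r comp0l.
  by exists (c^-1 *: w); rewrite compZr e scalerA mulVf ?scale1r.
by left.
Qed.

End CyclesAtMouth.

(** * Direct sums of maps and of triangles *)

Section DirectSums.
Variable k : fieldType.
Implicit Type C : linCat k.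

(** [is_direct_sum] with its structure maps kept as data. *)
Record dsum C (X A B : C) := DSum {
  in1 : hom A X; in2 : hom B X; pr1 : hom X A; pr2 : hom X B;
  pr1_in1 : pr1 ∘ in1 = idm A;
  pr2_in2 : pr2 ∘ in2 = idm B;
  pr2_in1 : pr2 ∘ in1 = 0;
  pr1_in2 : pr1 ∘ in2 = 0;
  in_pr : in1 ∘ pr1 + in2 ∘ pr2 = idm X
}.

Lemma dsum_of_is_direct_sum C (X A B : C) :
  is_direct_sum X A B -> inhabited (dsum X A B).
Proof. by move=> [i [j [p [q [e1 e2 e3 e4 e5]]]]]; split; exists i j p q. Qed.

Definition fmap_dsum C D (F : functor C D) (X A B : C) (d : dsum X A B) :
  dsum (F X) (F A) (F B).
Proof.
exists (fmap F (in1 d)) (fmap F (in2 d)) (fmap F (pr1 d)) (fmap F (pr2 d)).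
- by rewrite -fmap_comp pr1_in1 fmap_id.
- by rewrite -fmap_comp pr2_in2 fmap_id.
- by rewrite -fmap_comp pr2_in1 fmap0.
- by rewrite -fmap_comp pr1_in2 fmap0.
- by rewrite -!fmap_comp -fmapD in_pr fmap_id.
Defined.

Section Maps.
Variable C : linCat k.
Implicit Types X Y A B W : C.

Lemma dsum_ext X A B (d : dsum X A B) W (u v : hom X W) :
  u ∘ in1 d = v ∘ in1 d -> u ∘ in2 d = v ∘ in2 d -> u = v.
Proof.
move=> e1 e2; rewrite -[u]comp_idr -[v]comp_idr -(in_pr d) !compDr !comp_assoc.
by rewrite e1 e2.
Qed.

Lemma dsum_coext X A B (d : dsum X A B) W (u v : hom W X) :
  pr1 d ∘ u = pr1 d ∘ v -> pr2 d ∘ u = pr2 d ∘ v -> u = v.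
Proof.
move=> e1 e2; rewrite -[u]comp_idl -[v]comp_idl -(in_pr d) !compDl.
by rewrite -!comp_assoc e1 e2.
Qed.

Definition copair X A B (d : dsum X A B) W (u : hom A W) (v : hom B W) :=
  u ∘ pr1 d + v ∘ pr2 d.

Definition pair_map X A B (d : dsum X A B) W (u : hom W A) (v : hom W B) :=
  in1 d ∘ u + in2 d ∘ v.

Lemma copair_in1 X A B (d : dsum X A B) W (u : hom A W) (v : hom B W) :
  copair d u v ∘ in1 d = u.
Proof.
by rewrite /copair compDl -!comp_assoc pr1_in1 pr2_in1 comp_idr comp0r addr0.
Qed.

Lemma copair_in2 X A B (d : dsum X A B) W (u : hom A W) (v : hom B W) :
  copair d u v ∘ in2 d = v.
Proof.
by rewrite /copair compDl -!comp_assoc pr1_in2 pr2_in2 comp_idr comp0r add0r.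
Qed.

Lemma pr1_pair_map X A B (d : dsum X A B) W (u : hom W A) (v : hom W B) :
  pr1 d ∘ pair_map d u v = u.
Proof.
by rewrite /pair_map compDr !comp_assoc pr1_in1 pr1_in2 comp_idl comp0l addr0.
Qed.

Lemma pr2_pair_map X A B (d : dsum X A B) W (u : hom W A) (v : hom W B) :
  pr2 d ∘ pair_map d u v = v.
Proof.
by rewrite /pair_map compDr !comp_assoc pr2_in1 pr2_in2 comp_idl comp0l add0r.
Qed.

Definition dmap X A B X' A' B' (d : dsum X A B) (d' : dsum X' A' B')
    (u : hom A A') (v : hom B B') : hom X X' :=
  copair d (in1 d' ∘ u) (in2 d' ∘ v).

Section DMap.
Variables (X A B X' A' B' : C) (d : dsum X A B) (d' : dsum X' A' B').

Lemma dmap_in1 u v : dmap d d' u v ∘ in1 d = in1 d' ∘ u.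
Proof. exact: copair_in1. Qed.

Lemma dmap_in2 u v : dmap d d' u v ∘ in2 d = in2 d' ∘ v.
Proof. exact: copair_in2. Qed.

Lemma pr1_dmap u v : pr1 d' ∘ dmap d d' u v = u ∘ pr1 d.
Proof.
apply: (dsum_ext (d := d)); rewrite -!comp_assoc ?dmap_in1 ?dmap_in2.
  by rewrite comp_assoc pr1_in1 pr1_in1 comp_idl comp_idr.
by rewrite comp_assoc !pr1_in2 comp0l comp0r.
Qed.

Lemma pr2_dmap u v : pr2 d' ∘ dmap d d' u v = v ∘ pr2 d.
Proof.
apply: (dsum_ext (d := d)); rewrite -!comp_assoc ?dmap_in1 ?dmap_in2.
  by rewrite comp_assoc !pr2_in1 comp0l comp0r.
by rewrite comp_assoc pr2_in2 pr2_in2 comp_idl comp_idr.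
Qed.

Lemma dmap_lin a u u' v v' :
  dmap d d' (a *: u + u') (a *: v + v') = a *: dmap d d' u v + dmap d d' u' v'.
Proof.
apply: (dsum_ext (d := d)); rewrite [RHS]compDl compZl ?dmap_in1 ?dmap_in2;
  by rewrite compDr compZr.
Qed.

End DMap.

Lemma dmap_id X A B (d : dsum X A B) : dmap d d (idm A) (idm B) = idm X.
Proof.
by apply: (dsum_ext (d := d)); rewrite ?dmap_in1 ?dmap_in2 comp_idl comp_idr.
Qed.

Lemma dmap_comp X A B X' A' B' X'' A'' B'' (d : dsum X A B)
    (d' : dsum X' A' B') (d'' : dsum X'' A'' B'') u v u' v' :
  dmap d' d'' u' v' ∘ dmap d d' u v = dmap d d'' (u' ∘ u) (v' ∘ v).
Proof.
by apply: (dsum_ext (d := d)); rewrite -comp_assoc ?dmap_in1 ?dmap_in2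
  comp_assoc ?dmap_in1 ?dmap_in2 comp_assoc.
Qed.

Definition diag1 X A B X' A' B' (d : dsum X A B) (d' : dsum X' A' B')
  (u : hom X X') : hom A A' := pr1 d' ∘ u ∘ in1 d.

Definition diag2 X A B X' A' B' (d : dsum X A B) (d' : dsum X' A' B')
  (u : hom X X') : hom B B' := pr2 d' ∘ u ∘ in2 d.

Lemma diag1_dmap X A B X' A' B' (d : dsum X A B) (d' : dsum X' A' B') u v :
  diag1 d d' (dmap d d' u v) = u.
Proof. by rewrite /diag1 pr1_dmap -comp_assoc pr1_in1 comp_idr. Qed.

Lemma diag2_dmap X A B X' A' B' (d : dsum X A B) (d' : dsum X' A' B') u v :
  diag2 d d' (dmap d d' u v) = v.
Proof. by rewrite /diag2 pr2_dmap -comp_assoc pr2_in2 comp_idr. Qed.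

Lemma diag1_id X A B (d : dsum X A B) : diag1 d d (idm X) = idm A.
Proof. by rewrite /diag1 comp_idr pr1_in1. Qed.

Lemma diag2_id X A B (d : dsum X A B) : diag2 d d (idm X) = idm B.
Proof. by rewrite /diag2 comp_idr pr2_in2. Qed.

(** Between objects decomposed along two orthogonal subcategories every map is
    diagonal; this is why taking diagonal entries is functorial. *)
Lemma dmap_diag X A B X' A' B' (d : dsum X A B) (d' : dsum X' A' B')
    (u : hom X X') : orth A B' -> orth B A' ->
  dmap d d' (diag1 d d' u) (diag2 d d' u) = u.
Proof.
move=> o1 o2; apply: (dsum_ext (d := d)); rewrite ?dmap_in1 ?dmap_in2;
  apply: (dsum_coext (d := d')); rewrite !comp_assoc.
- by rewrite pr1_in1 comp_idl.
- by rewrite pr2_in1 !comp0l; exact: esym (o1 _).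
- by rewrite pr1_in2 !comp0l; exact: esym (o2 _).
- by rewrite pr2_in2 comp_idl.
Qed.

Section DiagComp.
Variables (X A B X' A' B' X'' A'' B'' : C) (d : dsum X A B)
  (d' : dsum X' A' B') (d'' : dsum X'' A'' B'') (u : hom X X') (v : hom X' X'').
Hypotheses (oAB : orth A B') (oBA : orth B A') (oAB' : orth A' B'')
  (oBA' : orth B' A'').

Lemma diag1_comp : diag1 d' d'' v ∘ diag1 d d' u = diag1 d d'' (v ∘ u).
Proof.
rewrite -{2}(dmap_diag d d' u) // -{2}(dmap_diag d' d'' v) //.
by rewrite dmap_comp diag1_dmap.
Qed.

Lemma diag2_comp : diag2 d' d'' v ∘ diag2 d d' u = diag2 d d'' (v ∘ u).
Proof.
rewrite -{2}(dmap_diag d d' u) // -{2}(dmap_diag d' d'' v) //.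
by rewrite dmap_comp diag2_dmap.
Qed.

End DiagComp.
End Maps.

Lemma fmap_dmap C D (F : functor C D) (X A B X' A' B' : C) (d : dsum X A B)
    (d' : dsum X' A' B') u v :
  fmap F (dmap d d' u v) =
  dmap (fmap_dsum F d) (fmap_dsum F d') (fmap F u) (fmap F v).
Proof. by rewrite [LHS]fmapD !fmap_comp. Qed.

End DirectSums.

Section SumOfTriangles.
Variables (k : fieldType) (T : triCat k).

(** The sum of two triangles maps to and from the triangle on a cone [Q] of the
    sum of the first maps. The two composites are endomorphisms of triangles
    that are the identity at two vertices, hence invertible. *)
Lemma dist_dsum (X X1 X2 Y Y1 Y2 Z Z1 Z2 : T) (dX : dsum X X1 X2)
    (dY : dsum Y Y1 Y2) (dZ : dsum Z Z1 Z2)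
    (f1 : hom X1 Y1) (g1 : hom Y1 Z1) (h1 : hom Z1 (shift T X1))
    (f2 : hom X2 Y2) (g2 : hom Y2 Z2) (h2 : hom Z2 (shift T X2)) :
  dist f1 g1 h1 -> dist f2 g2 h2 ->
  dist (dmap dX dY f1 f2) (dmap dY dZ g1 g2)
       (dmap dZ (fmap_dsum (shift T) dX) h1 h2).
Proof.
move=> D1 D2; pose dSX := fmap_dsum (shift T) dX.
set F := dmap dX dY f1 f2; set G := dmap dY dZ g1 g2.
set H := dmap dZ _ h1 h2.
have [Q [b [b' DQ]]] := dist_cone F.
have [c1 [c1g c1h]] := dist_mor D1 DQ (esym (dmap_in1 dX dY f1 f2)).
have [c2 [c2g c2h]] := dist_mor D2 DQ (esym (dmap_in2 dX dY f1 f2)).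
have [r1 [r1g r1h]] := dist_mor DQ D1 (pr1_dmap dX dY f1 f2).
have [r2 [r2g r2h]] := dist_mor DQ D2 (pr2_dmap dX dY f1 f2).
pose c := copair dZ c1 c2; pose r := pair_map dZ r1 r2.
have cG : c ∘ G = b.
  apply: (dsum_ext (d := dY)); rewrite -comp_assoc ?dmap_in1 ?dmap_in2;
  by rewrite comp_assoc ?copair_in1 ?copair_in2.
have Hc : b' ∘ c = H.
  apply: (dsum_ext (d := dZ)); rewrite -comp_assoc ?copair_in1 ?copair_in2;
  by rewrite ?dmap_in1 ?dmap_in2.
have rb : r ∘ b = G.
  apply: (dsum_coext (d := dZ)); rewrite comp_assoc ?pr1_pair_map ?pr2_pair_map;
  by rewrite ?pr1_dmap ?pr2_dmap.
have Hr : H ∘ r = b'.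
  apply: (dsum_coext (d := dSX)); rewrite comp_assoc ?pr1_dmap ?pr2_dmap;
  by rewrite -comp_assoc ?pr1_pair_map ?pr2_pair_map.
have DQ' := (proj1 (dist_rot _ _ _)) DQ.
have rc_iso : is_iso (r ∘ c).
  apply: (@triangle_end_iso k T _ _ _ G H).
  - move=> n nG.
    have [m1 e1] : exists m1, n ∘ in1 dZ = m1 ∘ h1.
      apply: (dist_extend ((proj1 (dist_rot _ _ _)) D1)).
      by rewrite -comp_assoc -(dmap_in1 dY dZ g1 g2) comp_assoc nG comp0l.
    have [m2 e2] : exists m2, n ∘ in2 dZ = m2 ∘ h2.
      apply: (dist_extend ((proj1 (dist_rot _ _ _)) D2)).
      by rewrite -comp_assoc -(dmap_in2 dY dZ g1 g2) comp_assoc nG comp0l.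
    exists (copair dSX m1 m2); apply: (dsum_ext (d := dZ));
      rewrite -comp_assoc ?dmap_in1 ?dmap_in2 comp_assoc;
    by rewrite ?(copair_in1 dSX) ?(copair_in2 dSX).
  - by rewrite -comp_assoc cG.
  - by rewrite comp_assoc Hr.
have cr_iso : is_iso (c ∘ r).
  apply: (@triangle_end_iso k T _ _ _ b b').
  - by move=> n; apply: (dist_extend DQ').
  - by rewrite -comp_assoc rb.
  - by rewrite comp_assoc Hc.
have [c' [e1 e2]] := iso_of_inverses rc_iso cr_iso.
apply: (dist_iso (a := idm _) (b := idm _) (c := c')) DQ;
  [exact: iso_idm | exact: iso_idm | by exists c | | | ].
- by rewrite comp_idl comp_idr.
- by rewrite -cG comp_assoc e1 comp_idl comp_idr.
- by rewrite fmap_id comp_idl -Hc -comp_assoc e2 comp_idr.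
Qed.

End SumOfTriangles.

(** * Products from orthogonal subcategories *)

Record triangulated_class (k : fieldType) (T : triCat k) (P : T -> Prop) :
  Prop := TriangulatedClass {
  class_zero : exists Z, is_zero Z /\ P Z;
  class_sum : forall X A B, is_direct_sum X A B -> P A -> P B -> P X;
  class_shift : forall X, P X -> P (shift T X);
  class_unshift : forall X, P X -> P (unshift T X);
  class_cone : forall (X Y Z : T) (f : hom X Y) (g : hom Y Z)
    (h : hom Z (shift T X)), dist f g h -> P X -> P Y -> P Z
}.

Section FullSubcategory.
Variables (k : fieldType) (T : triCat k) (P : T -> Prop).

Definition sub_cat : linCat k.
Proof.
refine (@LinCat k {X : T | P X} (fun X Y => hom (sval X) (sval Y))
  (fun X => idm (sval X)) (fun X Y Z g f => g ∘ f) _ _ _ _ _).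
- by move=> *; apply: comp_assoc.
- by move=> *; apply: comp_idl.
- by move=> *; apply: comp_idr.
- by move=> *; apply: comp_linl.
- by move=> *; apply: comp_linr.
Defined.

Lemma sub_cat_zero (X : sub_cat) : is_zero X <-> is_zero (sval X).
Proof. by rewrite !is_zero_idm. Qed.

Definition sub_functor (F : functor T T) (PF : forall X, P X -> P (F X)) :
  functor sub_cat sub_cat.
Proof.
refine (@Functor k sub_cat sub_cat
  (fun X => exist P (F (sval X)) (PF _ (svalP X))) (fun X Y f => fmap F f) _ _ _).
- by move=> *; apply: fmap_id.
- by move=> *; apply: fmap_comp.
- by move=> X Y a f g; apply: (@fmap_lin k T T F (sval X) (sval Y)).
Defined.

Definition sub_cancel (F G : functor T T) (PF : forall X, P X -> P (F X))
    (PG : forall X, P X -> P (G X))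
    (p : natIso (functor_comp G F) (functor_id T)) :
  natIso (functor_comp (sub_functor PG) (sub_functor PF)) (functor_id sub_cat).
Proof.
refine (@NatIso k sub_cat sub_cat
  (functor_comp (sub_functor PG) (sub_functor PF)) (functor_id sub_cat)
  (fun X => nat_fwd p (sval X)) (fun X => nat_bwd p (sval X)) _ _ _).
- by move=> X; apply: (nat_fwdK p).
- by move=> X; apply: (nat_bwdK p).
- by move=> X Y f; apply: (nat_natural p).
Defined.

Hypothesis PT : triangulated_class P.

Definition sub_tri : triCat k.
Proof.
refine (@TriCat k sub_cat (sub_functor (class_shift PT))
  (sub_functor (class_unshift PT)) (sub_cancel _ _ (shiftK T))
  (sub_cancel _ _ (unshiftK T))
  (fun X Y Z f g h => @dist k T (sval X) (sval Y) (sval Z) f g h)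
  _ _ _ _ _ _ _ _).
- have [Z [z PZ]] := class_zero PT; exists (exist P Z PZ).
  exact/sub_cat_zero.
- move=> [A PA] [B PB]; have [X s] := has_direct_sums A B.
  by exists (exist P X (class_sum PT s PA PB)).
- by move=> X Y Z X' Y' Z' f g h f' g' h' a b c; apply: dist_iso.
- by move=> X Z /sub_cat_zero z; apply: dist_id.
- move=> X Y f; have [Z [g [h D]]] := @dist_cone k T (sval X) (sval Y) f.
  by exists (exist P Z (class_cone PT D (svalP X) (svalP Y))), g, h.
- by move=> X Y Z f g h; apply: dist_rot.
- by move=> X Y Z X' Y' Z' f g h f' g' h' a b D D' e; apply: dist_mor D D' e.
- move=> X Y Z X' Y' Z' f a a' g b b' c c' D1 D2 D3.
  exact: dist_oct D1 D2 D3.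
Defined.

End FullSubcategory.

Section OrthogonalDecomposition.
Variables (k : fieldType) (T : triCat k) (P Q : T -> Prop).
Hypotheses (PT : triangulated_class P) (QT : triangulated_class Q).
Hypothesis oPQ : forall X Y, P X -> Q Y -> orth X Y.
Hypothesis oQP : forall X Y, P X -> Q Y -> orth Y X.
Hypothesis decomposes :
  forall X : T, exists A B, [/\ P A, Q B & is_direct_sum X A B].

Let PQ := prod_tri (sub_tri PT) (sub_tri QT).

(** Direct sums and decompositions are existence statements; functors need
    chosen ones. *)
Lemma sum_choice (A B : T) : {X : T & dsum X A B}.
Proof.
have : exists s : {X : T & dsum X A B}, True.
  have [X /dsum_of_is_direct_sum[d]] := has_direct_sums A B.
  by exists (existT _ X d).
by case/constructive_indefinite_description.
Qed.

Definition sum_obj (V : PQ) : T := projT1 (sum_choice (sval V.1) (sval V.2)).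
Definition sum_dsum (V : PQ) : dsum (sum_obj V) (sval V.1) (sval V.2) :=
  projT2 (sum_choice (sval V.1) (sval V.2)).

Definition sum_functor : functor PQ T.
Proof.
refine (@Functor k PQ T sum_obj
  (fun V W f => dmap (sum_dsum V) (sum_dsum W) f.1 f.2) _ _ _).
- by move=> V; apply: dmap_id.
- by move=> U V W g f; rewrite dmap_comp.
- by move=> V W a f g; apply: dmap_lin.
Defined.

Definition sum_shift :
  natIso (functor_comp sum_functor (shift PQ)) (functor_comp (shift T) sum_functor).
Proof.
refine (@NatIso k PQ T (functor_comp sum_functor (shift PQ))
  (functor_comp (shift T) sum_functor)
  (fun V => dmap (sum_dsum (shift PQ V)) (fmap_dsum (shift T) (sum_dsum V))
                 (idm _) (idm _))
  (fun V => dmap (fmap_dsum (shift T) (sum_dsum V)) (sum_dsum (shift PQ V))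
                 (idm _) (idm _)) _ _ _).
- by move=> V; rewrite dmap_comp !comp_idl; apply: dmap_id.
- by move=> V; rewrite dmap_comp !comp_idl; apply: dmap_id.
by move=> V W f; rewrite /= fmap_dmap !dmap_comp !comp_idl !comp_idr.
Defined.

Definition sum_tri_functor : triFunctor PQ T.
Proof.
refine (@TriFunctor k PQ T sum_functor sum_shift _).
move=> X Y Z f g h [D1 D2]; rewrite /= dmap_comp !comp_idl.
exact: (@dist_dsum k T _ _ _ _ _ _ _ _ _ (sum_dsum X) (sum_dsum Y)
  (sum_dsum Z) f.1 g.1 h.1 f.2 g.2 h.2 D1 D2).
Defined.

Lemma split_choice (X : T) : {V : PQ & dsum X (sval V.1) (sval V.2)}.
Proof.
have : exists s : {V : PQ & dsum X (sval V.1) (sval V.2)}, True.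
  have [A [B [PA QB /dsum_of_is_direct_sum[d]]]] := decomposes X.
  by exists (existT _ (exist P A PA, exist Q B QB) d).
by case/constructive_indefinite_description.
Qed.

Definition split_obj (X : T) : PQ := projT1 (split_choice X).
Definition split_dsum (X : T) :
    dsum X (sval (split_obj X).1) (sval (split_obj X).2) :=
  projT2 (split_choice X).

Lemma orth12 (V W : PQ) : orth (sval V.1) (sval W.2).
Proof. exact: oPQ (svalP V.1) (svalP W.2). Qed.

Lemma orth21 (V W : PQ) : orth (sval V.2) (sval W.1).
Proof. exact: oQP (svalP W.1) (svalP V.2). Qed.

Definition diag (X Y : T) (V W : PQ) (d : dsum X (sval V.1) (sval V.2))
    (d' : dsum Y (sval W.1) (sval W.2)) (u : hom X Y) : hom V W :=
  (diag1 d d' u, diag2 d d' u).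

Lemma diag_id (X : T) (V : PQ) (d : dsum X (sval V.1) (sval V.2)) :
  diag d d (idm X) = idm V.
Proof. by rewrite /diag diag1_id diag2_id. Qed.

Lemma diag_comp (X Y Z : T) (U V W : PQ) (d : dsum X (sval U.1) (sval U.2))
    (d' : dsum Y (sval V.1) (sval V.2)) (d'' : dsum Z (sval W.1) (sval W.2))
    (v : hom Y Z) (u : hom X Y) :
  diag d' d'' v ∘ diag d d' u = diag d d'' (v ∘ u).
Proof.
rewrite /diag -(diag1_comp d d' d'') -?(diag2_comp d d' d'') //;
  (exact: orth12 || exact: orth21).
Qed.

Definition split_functor : functor T PQ.
Proof.
refine (@Functor k T PQ split_obj
  (fun X Y u => diag (split_dsum X) (split_dsum Y) u) _ _ _).
- by move=> X; apply: diag_id.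
- by move=> X Y Z g f; rewrite diag_comp.
- move=> X Y a f g; congr pair; rewrite /= /diag1 /diag2;
  by rewrite compDr compZr compDl compZl.
Defined.

Lemma split_sum : natIso (functor_comp split_functor sum_functor) (functor_id PQ).
Proof.
refine (@NatIso k PQ PQ (functor_comp split_functor sum_functor) (functor_id PQ)
  (fun V => diag (split_dsum (sum_obj V)) (sum_dsum V) (idm (sum_obj V)))
  (fun V => diag (sum_dsum V) (split_dsum (sum_obj V)) (idm (sum_obj V))) _ _ _).
- by move=> V; rewrite diag_comp comp_idl; apply: diag_id.
- by move=> V; rewrite diag_comp comp_idl; apply: diag_id.
move=> V W f; rewrite [LHS]diag_comp comp_idl.
have -> : fmap (functor_id PQ) f =
    diag (sum_dsum V) (sum_dsum W) (fmap sum_functor f).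
  by case: f => f1 f2; congr pair; rewrite ?diag1_dmap ?diag2_dmap.
by rewrite [RHS]diag_comp comp_idr.
Qed.

Lemma sum_split : natIso (functor_comp sum_functor split_functor) (functor_id T).
Proof.
refine (@NatIso k T T (functor_comp sum_functor split_functor) (functor_id T)
  (fun X => dmap (sum_dsum (split_obj X)) (split_dsum X) (idm _) (idm _))
  (fun X => dmap (split_dsum X) (sum_dsum (split_obj X)) (idm _) (idm _)) _ _ _).
- by move=> X; rewrite dmap_comp !comp_idl; apply: dmap_id.
- by move=> X; rewrite dmap_comp !comp_idl; apply: dmap_id.
move=> X Y u; rewrite /= dmap_comp !comp_idl.
rewrite -[in RHS](dmap_diag (split_dsum X) (split_dsum Y) u);
  [|exact: orth12|exact: orth21].
by rewrite dmap_comp !comp_idr.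
Qed.

(** The equivalence sends (A, B) to the sum of A and B. Its quasi-inverse takes
    the two components of an object and the diagonal entries of a map. *)
Lemma orthogonal_decomposition : tri_equivalent PQ T.
Proof.
by exists sum_tri_functor, split_functor; split; split;
  [exact: split_sum | exact: sum_split].
Qed.

End OrthogonalDecomposition.

(** * Perpendicular subcategories and Krull-Schmidt decompositions *)

Section Perpendicular.
Variables (k : fieldType) (T : triCat k).
Implicit Types X Y Z A B : T.

Definition shift_stable (P : T -> Prop) : Prop :=
  forall X, P X -> P (shift T X) /\ P (unshift T X).

Definition perp (P : T -> Prop) : T -> Prop :=
  fun X => forall Y, P Y -> orth X Y /\ orth Y X.

Lemma perp_shift_stable P : shift_stable P -> shift_stable (perp P).
Proof.
move=> st X pX; split=> Y /st[PsY PuY].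
  have [o1 _] := pX _ PuY; have [_ o2] := pX _ PuY.
  by split; [apply/orth_shift | apply/orth_unshift].
have [o1 _] := pX _ PsY; have [_ o2] := pX _ PsY.
by split; [apply/orth_unshift | apply/orth_shift].
Qed.

(** Two-sided orthogonality makes the class closed under cones through the long
    exact sequences, with the shift needed at one end supplied by stability. *)
Lemma perp_triangulated P : shift_stable P -> triangulated_class (perp P).
Proof.
move=> st; have stp := perp_shift_stable st; split.
- have [Z zZ] := has_zero T; exists Z; split=> // Y _.
  by have [z1 z2] := zZ Y.
- move=> X A B [iA [iB [pA [pB [_ _ _ _ e]]]]] pA' pB' Y PY.
  have [a1 a2] := pA' Y PY; have [b1 b2] := pB' Y PY; split=> u.
    rewrite -[u]comp_idr -e compDr !comp_assoc (a1 (u ∘ iA)) (b1 (u ∘ iB)).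
    by rewrite !comp0l addr0.
  rewrite -[u]comp_idl -e compDl -!comp_assoc (a2 (pA ∘ u)) (b2 (pB ∘ u)).
  by rewrite !comp0r addr0.
- by move=> X /stp[].
- by move=> X /stp[].
move=> X Y Z f g h D pX pY W PW; have [psX _] := stp X pX.
have [y1 y2] := pY W PW; have [x1 x2] := psX W PW.
have D' := (proj1 (dist_rot _ _ _)) D; split=> u.
  by have [q ->] := dist_extend D' (y1 (u ∘ g)); rewrite (x1 q) comp0l.
by have [v ->] := dist_lift D' (x2 (h ∘ u)); rewrite (y2 v) comp0r.
Qed.

Lemma perp_perp P X : P X -> perp (perp P) X.
Proof. by move=> PX Y /(_ X PX)[]. Qed.

Definition shift_orbit A : T -> Prop := fun X => exists i, isomorphic X (shiftz A i).

Lemma shift_orbit_stable A : shift_stable (shift_orbit A).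
Proof.
move=> X [i e]; split; [exists (i + 1) | exists (i - 1)].
  exact: isomorphic_trans (fmap_isomorphic (shift T) e) (shiftz_succ A i).
exact: isomorphic_trans (fmap_isomorphic (unshift T) e) (shiftz_pred A i).
Qed.

(** Splitting of idempotents is not an axiom, so the summand of X on a set of
    indices is rebuilt from binary direct sums. *)
Lemma partial_sum (P : T -> Prop) (PT : triangulated_class P) X n
    (A : 'I_n -> T) (i_ : forall j, hom (A j) X) (p_ : forall j, hom X (A j))
    (e1 : forall j, p_ j ∘ i_ j = idm (A j))
    (e2 : forall j l, j != l -> p_ l ∘ i_ j = 0) (s : seq 'I_n) :
  uniq s -> (forall j, j \in s -> P (A j)) ->
  exists (B : T) (i : hom B X) (p : hom X B),
    [/\ P B, p ∘ i = idm B & i ∘ p = \sum_(j <- s) i_ j ∘ p_ j].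
Proof.
elim: s => [_ _|j s IH /= /andP[js us] Ps].
  have [Z [z PZ]] := class_zero PT; exists Z, 0, 0; split=> //.
    by rewrite comp0r; apply/esym/is_zero_idm.
  by rewrite comp0r big_nil.
have [|B [i [p [PB pi ip]]]] := IH us.
  by move=> l ls; apply: Ps; rewrite inE ls orbT.
have ne l : l \in s -> l != j by apply: contraTneq => ->.
have pji : p_ j ∘ i = 0.
  rewrite -[i]comp_idr -pi [i ∘ _]comp_assoc ip comp_assoc comp_sumr comp_suml.
  rewrite big_seq big1 // => l /ne lj.
  by rewrite comp_assoc e2 // !comp0l.
have pij : p ∘ i_ j = 0.
  rewrite -[p]comp_idl -pi -comp_assoc -comp_assoc [i ∘ _]comp_assoc ip.
  rewrite comp_suml comp_sumr big_seq big1 // => l /ne lj.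
  by rewrite -comp_assoc e2 1?eq_sym // !comp0r.
have [Y sY] := has_direct_sums (A j) B.
have [d] := dsum_of_is_direct_sum sY.
exists Y, (copair d (i_ j) i), (pair_map d (p_ j) p); split.
- by apply: (class_sum PT sY) => //; apply: Ps; rewrite inE eqxx.
- apply: (dsum_ext (d := d)); rewrite comp_idl -comp_assoc
    ?copair_in1 ?copair_in2; apply: (dsum_coext (d := d));
  rewrite comp_assoc ?pr1_pair_map ?pr2_pair_map.
  + by rewrite e1 pr1_in1.
  + by rewrite pij pr2_in1.
  + by rewrite pji pr1_in2.
  + by rewrite pi pr2_in2.
rewrite big_cons -ip /pair_map compDr !comp_assoc.
by rewrite copair_in1 copair_in2.
Qed.

(** The indecomposable summands in P are collected into one object and the others
    into another; the mixed components vanish by orthogonality. *)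
Lemma split_along_summands (P Q : T -> Prop) (TKS : krull_schmidt T) :
  triangulated_class P -> triangulated_class Q ->
  (forall X Y, P X -> Q Y -> orth X Y /\ orth Y X) ->
  (forall X, local_end X -> P X \/ Q X) ->
  forall X, exists A B, [/\ P A, Q B & is_direct_sum X A B].
Proof.
move=> PT QT o dich X; have [n [A [[i_ [p_ [e1 e2 e3]]] loc]]] := TKS X.
pose b j : bool := if excluded_middle_informative (P (A j)) then true else false.
have bP j : b j -> P (A j).
  by rewrite /b; case: (excluded_middle_informative _).
have bQ j : ~~ b j -> Q (A j).
  rewrite /b; case: (excluded_middle_informative _) => // nP _.
  by case: (dich _ (loc j)).
have [|B [iB [pB [PB eB sB]]]] := @partial_sum P PT X n A i_ p_ e1 e2
  [seq j <- index_enum 'I_n | b j] (filter_uniq _ (index_enum_uniq _)).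
  by move=> j; rewrite mem_filter => /andP[/bP].
have [|C [iC [pC [QC eC sC]]]] := @partial_sum Q QT X n A i_ p_ e1 e2
  [seq j <- index_enum 'I_n | ~~ b j] (filter_uniq _ (index_enum_uniq _)).
  by move=> j; rewrite mem_filter => /andP[/bQ].
have [oBC oCB] := o _ _ PB QC.
exists B, C; split=> //; exists iB, iC, pB, pC; split=> //.
by rewrite sB sC -e3 !big_filter [RHS](bigID b).
Qed.

End Perpendicular.

Section NoZeroCalabiYauSummand.
Variables (k : fieldType) (T : triCat k) (S : serreFunctor T).
Hypotheses (Thom : hom_finite T) (TKS : krull_schmidt T).
Hypothesis Tind : indecomposable_cat T.
Implicit Types X A B : T.

(** A 0-Calabi-Yau object with End(A) = k; the Auslander-Reiten triangle ending at
    such an object has zero middle term. *)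
Definition spherical0 A : Prop := dual_end (0 : hom A A) /\ isomorphic (S A) A.

Lemma spherical0_shift A : spherical0 A -> spherical0 (shift T A).
Proof.
move=> [d i]; split.
  by have := dual_end_fmap (@shift_ff k T) d; rewrite fmap0.
exact: isomorphic_trans (nat_iso_isomorphic (tfun_shift S) A)
  (fmap_isomorphic (shift T) i).
Qed.

Lemma spherical0_unshift A : spherical0 A -> spherical0 (unshift T A).
Proof.
move=> [d i]; split.
  by have := dual_end_fmap (@unshift_ff k T) d; rewrite fmap0.
apply: isomorphic_trans (fmap_isomorphic (unshift T) i).
apply: isomorphic_trans (isomorphic_sym (unshift_shift _)) _.
apply: fmap_isomorphic; apply: isomorphic_trans
  (fmap_isomorphic S (shift_unshift A)).
exact: isomorphic_sym (nat_iso_isomorphic (tfun_shift S) (unshift T A)).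
Qed.

Lemma spherical0_shiftz A i : spherical0 A -> spherical0 (shiftz A i).
Proof.
move=> sA; case: i => n; elim: n => [|n IH] //=.
- exact: spherical0_shift.
- exact: spherical0_unshift.
- exact: spherical0_unshift.
Qed.

Lemma spherical0_iso A B : isomorphic A B -> spherical0 A -> spherical0 B.
Proof.
move=> e [d i]; split; first exact: scalar_end_isomorphic e d.
apply: isomorphic_trans (fmap_isomorphic S (isomorphic_sym e)) _.
exact: isomorphic_trans i e.
Qed.

(** Serre duality completes a nonzero map between X and B to a nonzero, hence
    invertible, endomorphism of B, so B is a summand of X. *)
Lemma local_hom_spherical0 X B : local_end X -> spherical0 B ->
  ~ (orth X B /\ orth B X) -> isomorphic X B.
Proof.
move=> loc [d [w [w' [e1 e2]]]] no; have [B0 _ _] := d.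
apply: NNPP => nXB; apply: no; split=> u; apply: NNPP => u0; apply: nXB.
  have [f f0] : exists f : hom B X, (w' ∘ u) ∘ f <> 0.
    apply: (serre_nondeg_right_comp Thom) => e; apply: u0.
    by rewrite -[u]comp_idl -e2 -comp_assoc e comp0r.
  have [s [e _]] : is_iso (u ∘ f).
    by apply: scalar_end_iso d _ => e; apply: f0; rewrite -comp_assoc e comp0r.
  apply: isomorphic_sym; exists f; apply: (local_retract_iso (p := s ∘ u)) => //.
  by rewrite -comp_assoc.
have [v v0] := serre_nondeg_left S u0.
have [s [e _]] : is_iso (w ∘ (v ∘ u)).
  apply: scalar_end_iso d _ => e; apply: v0.
  by rewrite -[v ∘ u]comp_idl -e1 -comp_assoc e comp0r.
apply: isomorphic_sym; exists u; apply: (local_retract_iso (p := s ∘ (w ∘ v))) => //.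
by rewrite -!comp_assoc.
Qed.

(** An object with local endomorphism ring is either isomorphic to a shift of A
    or orthogonal to all of them. Hence T is the product of the perpendicular of
    the shifts of A, which contains B, and the perpendicular of that, which
    contains A; indecomposability of T leaves no room for a nonzero B. *)
Lemma spherical0_generates A B : spherical0 A ->
  (forall i, orth A (shiftz B i)) -> (forall i, orth B (shiftz A i)) ->
  is_zero B.
Proof.
move=> sA oAB oBA; apply: NNPP => nzB.
pose N := perp (shift_orbit A); pose M := perp N.
have st := @shift_orbit_stable _ _ A.
have NT : triangulated_class N := perp_triangulated st.
have MT : triangulated_class M := perp_triangulated (perp_shift_stable st).
apply: Tind; exists (sub_tri MT), (sub_tri NT); split.
- have MA : M A by apply: perp_perp; exists 0; apply: isomorphic_refl.
  exists (exist M A MA) => /sub_cat_zero/is_zero_idm.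
  by have [[]] := sA.
- have NB : N B.
    move=> Y [i /isomorphic_sym e]; split.
      exact: orth_iso (isomorphic_refl B) e (oBA i).
    apply: orth_iso e (isomorphic_refl B) _.
    exact/orth_shiftz.
  by exists (exist N B NB) => /sub_cat_zero.
apply: orthogonal_decomposition.
- by move=> X Y MX NY; have [] := MX Y NY.
- by move=> X Y MX NY; have [] := MX Y NY.
apply: split_along_summands => //; first by move=> X Y MX; apply: MX.
move=> X loc.
have [NX|nNX] := classic (N X); [by right | left].
apply: perp_perp; apply: NNPP => nO; apply: nNX => Y [i e].
have loc_sph := @local_hom_spherical0 X Y loc.
apply: NNPP => no; apply: nO; exists i; apply: (isomorphic_trans _ e).
apply: loc_sph => //; apply: spherical0_iso (isomorphic_sym e) _.
exact: spherical0_shiftz.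
Qed.

End NoZeroCalabiYauSummand.

(** * The 0-Calabi-Yau 1-cycles *)

Section ZeroCalabiYau.
Variables (k : closedFieldType) (T : triCat k) (S : serreFunctor T).
Hypotheses (Thom : hom_finite T) (TKS : krull_schmidt T).
Hypothesis Tind : indecomposable_cat T.
Variable E : T.
Hypothesis SE : isomorphic (S E) E.
Hypothesis plane : lin_iso (hom E E) ('rV[k]_1 * 'rV[k]_1)%type.
Hypothesis concentrated : forall i, i != 0 -> orth E (shiftz E i).

Section TwoSummands.
Variables (A B : T) (iA : hom A E) (pA : hom E A) (iB : hom B E) (pB : hom E B).
Hypotheses (eA : pA ∘ iA = idm A) (eB : pB ∘ iB = idm B).
Hypotheses (eBA : pB ∘ iA = 0) (eAB : pA ∘ iB = 0).
Hypotheses (A0 : idm A <> 0) (B0 : idm B <> 0).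

Lemma summand_idempotents_span (v : hom E E) :
  exists a b, v = a *: (iA ∘ pA) + b *: (iB ∘ pB).
Proof.
apply: plane_basis plane _ _ _ _ => a b e; split; apply/eqP.
  apply: contraT => a0; case: A0; apply: (scalerI a0); rewrite scaler0.
  have := congr1 (fun u => pA ∘ u ∘ iA) e.
  rewrite compDr !compZr !comp_assoc eA eAB !comp0l scaler0 addr0 comp_idl.
  by rewrite compZl eA comp0r comp0l.
apply: contraT => b0; case: B0; apply: (scalerI b0); rewrite scaler0.
have := congr1 (fun u => pB ∘ u ∘ iB) e.
rewrite compDr !compZr !comp_assoc eB eBA !comp0l scaler0 add0r comp_idl.
by rewrite compZl eB comp0r comp0l.
Qed.

Lemma summands_orth : orth A B.
Proof.
move=> t; have [a [b e]] := summand_idempotents_span (iB ∘ t ∘ pA).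
have := congr1 (fun u => pB ∘ u ∘ iA) e.
rewrite compDr !compZr !comp_assoc eB eBA !comp0l scaler0 add0r !comp_idl.
by rewrite -comp_assoc eA comp_idr compZl eBA scaler0.
Qed.

Lemma summand_scalar_end : dual_end (0 : hom A A).
Proof.
split=> // [|t]; first by rewrite comp0l.
have [a [b e]] := summand_idempotents_span (iA ∘ t ∘ pA).
exists a, 0; rewrite scaler0 addr0.
have := congr1 (fun u => pA ∘ u ∘ iA) e.
rewrite compDr !compZr !comp_assoc eA eAB !comp0l scaler0 addr0 !comp_idl.
by rewrite -comp_assoc eA comp_idr compZl eA.
Qed.

(** A nonzero map A -> SA -> SE = E has no component in B, so its component in
    A is invertible and A is a summand of the indecomposable object SA. *)
Lemma summand_spherical0 : spherical0 S A.
Proof.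
have dA := summand_scalar_end; split=> //; apply: isomorphic_sym.
have [h] := serre_nondeg_left S A0; rewrite comp_idr => h0.
have [w [w' [e1 e2]]] := SE; pose m := w ∘ fmap S iA ∘ h.
have hm : h = fmap S pA ∘ w' ∘ m.
  rewrite /m -!comp_assoc (comp_assoc w') e1 comp_idl comp_assoc -fmap_comp.
  by rewrite eA fmap_id comp_idl.
have m0 : m <> 0 by move=> e; apply: h0; rewrite hm e comp0r.
have [s [e _]] : is_iso (pA ∘ m).
  apply: scalar_end_iso dA _ => e; apply: m0.
  have [a [b eE]] := summand_idempotents_span (idm E).
  rewrite -[m]comp_idl eE compDl !compZl -!comp_assoc e.
  by rewrite (summands_orth (pB ∘ m)) !comp0r !scaler0 addr0.
exists h; apply: (@local_retract_iso _ _ _ _ _ (s ∘ pA ∘ w ∘ fmap S iA)) => //.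
  apply: dual_end_local; exact: (dual_end_fmap (serre_ff S) dA).
by rewrite -e /m !comp_assoc.
Qed.

End TwoSummands.

(** If E were a sum of several local objects, its two-dimensional endomorphism
    ring would be spanned by the idempotents of two of them. These two would be
    orthogonal to all shifts of one another, and the first would be isomorphic to its
    image under S, against the indecomposability of T. *)
Lemma zero_cy_local : local_end E.
Proof.
have [n [A [[i_ [p_ [e1 e2 e3]]] loc]]] := TKS E.
have n0 j : idm (A j) <> 0 by have [] := loc j.
case: n A i_ p_ e1 e2 e3 loc n0 => [|[|n]] A i_ p_ e1 e2 e3 loc n0.
- have [f [g fg gf]] := plane.
  have z (u : hom E E) : u = 0 by rewrite -[u]comp_idr -e3 big_ord0 comp0r.
  have := gf (const_mx 1, 0); rewrite (z (g _)) linear0.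
  move=> /(congr1 fst)/rowP/(_ 0); rewrite !mxE => /eqP.
  by rewrite eq_sym oner_eq0.
- apply: local_end_iso (loc ord0); exists (i_ ord0), (p_ ord0); split=> //.
  by rewrite -e3 big_ord1.
pose j1 : 'I_n.+2 := lift ord0 ord0; have j01 : ord0 != j1 by [].
have j10 : j1 != ord0 by [].
have sph := summand_spherical0 (e1 ord0) (e1 j1) (e2 _ _ j01) (e2 _ _ j10)
  (n0 ord0) (n0 j1).
have oAB := summands_orth (e1 ord0) (e1 j1) (e2 _ _ j01) (e2 _ _ j10)
  (n0 ord0) (n0 j1).
have oBA := summands_orth (e1 j1) (e1 ord0) (e2 _ _ j10) (e2 _ _ j01)
  (n0 j1) (n0 ord0).
have ret j : retract (A j) E by exists (i_ j), (p_ j).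
have o j l i : i != 0 -> orth (A j) (shiftz (A l) i).
  move=> i0; apply: orth_retract (ret j) _ (concentrated i0).
  exact/shiftz_retract/ret.
case: (n0 j1); apply/is_zero_idm.
apply: (spherical0_generates Thom TKS Tind sph) => i;
  by have [->|/o] := eqVneq i 0.
Qed.

Lemma zero_cy_at_mouth : at_mouth E.
Proof.
have [x [dx x0]] := local_plane_dual plane zero_cy_local.
exact: (one_cycle_at_mouth_dual Thom dx x0 SE (@concentrated 1 isT)).
Qed.

End ZeroCalabiYau.

Theorem theorem1p1 (k : closedFieldType) (T : triCat k) (S : serreFunctor T)
    (Thom : hom_finite T) (TKS : krull_schmidt T)
    (Tind : indecomposable_cat T) (Thl : homotopy_like T) :
  (forall E : T, exceptional_1cycle S E -> indecomposable E /\ at_mouth E) /\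
  (forall (n : nat) (E : 'I_n -> T), (3 <= n)%N -> exceptional_cycle S E ->
     forall i : 'I_n, at_mouth (E i)).
Proof.
split=> [E [d [iS gr]]|n E n3 cyc]; last exact: exceptional_cycle_at_mouth cyc.
suff mE : at_mouth E by split=> //; case: mE.
have [d0|d0] := eqVneq d 0; last exact: one_cycle_at_mouth_shifted d0 iS gr.
rewrite d0 in iS gr; apply: (zero_cy_at_mouth Thom TKS Tind iS (gr 0)) => i i0.
apply: orth_of_sum0; have := gr i; rewrite /gr_sum /kgr.
by rewrite (negPf i0).
Qed.
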